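(* Let $G$ be any non-solvable subgroup of $\mathrm{SL}(2,\mathbb{Z})$, and let $G \ltimes \mathbb{Z}^2$ be the semidirect product in which $G$ acts on $\mathbb{Z}^2$ by its standard linear action by matrices. Then the group $G \ltimes \mathbb{Z}^2$ does not embed into $\mathrm{Diff}^1_+(\mathrm{S}^1)$; that is, there is no injective group homomorphism $G \ltimes \mathbb{Z}^2 \to \mathrm{Diff}^1_+(\mathrm{S}^1)$.
   Context: $\mathrm{Diff}^1_+(\mathrm{S}^1)$ denotes the group, under composition, of orientation-preserving $C^1$ diffeomorphisms of the circle $\mathrm{S}^1$ (bijections of class $C^1$ with inverse of class $C^1$). A matrix $f=\begin{pmatrix} a & b\\ c & d\end{pmatrix}\in \mathrm{SL}(2,\mathbb{Z})$ acts on $\mathbb{Z}^2$ by $f(1,0)=(a,c)$ and $f(0,1)=(b,d)$. In the semidirect product, $\mathbb{Z}^2$ is the normal factor and conjugation by elements of $G$ induces this action. *)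

(* Defs.v *)
From HB Require Import structures.
From mathcomp Require Import all_boot all_order all_algebra.
From mathcomp Require Import all_classical all_reals all_analysis.
From mathcomp Require Import zify.

Set Implicit Arguments.
Unset Strict Implicit.
Unset Printing Implicit Defensive.

Import Order.TTheory GRing.Theory Num.Theory.
Import numFieldNormedType.Exports.

Local Open Scope classical_set_scope.
Local Open Scope ring_scope.

Section Solvable.
Variable gT : groupType.

Definition is_subgroup (H : set gT) : Prop :=
  H 1%g /\ forall x y, H x -> H y -> H (x * y^-1)%g.

Definition derived_subgroup (H : set gT) : set gT :=
  smallest is_subgroup [set [~ x, y]%g | x in H & y in H].

(* [solvable] of mathcomp.solvable is restricted to finite groups. *)
Definition solvable_group : Prop :=
  exists n, iter n derived_subgroup [set: gT] = [set 1%g].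

End Solvable.

Section SubgroupType.
Variables (gT : groupType) (G : groupClosed gT).

Definition subgroup_type : Type := {x : gT | x \in G}.

HB.instance Definition _ := Choice.on subgroup_type.
HB.instance Definition _ := SubType.on subgroup_type.

Fact subgroup_type_closed : group_closed (G : {pred gT}).
Proof. by split; [exact: gpred1 | exact: gpredF]. Qed.

HB.instance Definition _ :=
  SubChoice_isSubGroup.Build gT (fun x => x \in G) subgroup_type
    subgroup_type_closed.

End SubgroupType.

Section SL2Z.

Definition SL2Z : Type := {A : 'M[int]_2 | \det A == 1}.

HB.instance Definition _ := Choice.on SL2Z.
HB.instance Definition _ := SubType.on SL2Z.

Implicit Types A B C : SL2Z.

Lemma SL2Z_unitmx A : val A \in unitmx.
Proof. by rewrite unitmxE (eqP (valP A)) unitr1. Qed.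

Fact SL2Z_one_subproof : \det (1%:M : 'M[int]_2) == 1.
Proof. by rewrite det1. Qed.

Fact SL2Z_mul_subproof A B : \det (val A *m val B) == 1.
Proof. by rewrite det_mulmx (eqP (valP A)) (eqP (valP B)) mulr1. Qed.

Fact SL2Z_inv_subproof A : \det (invmx (val A)) == 1.
Proof. by rewrite det_inv (eqP (valP A)) invr1. Qed.

Definition SL2Z_one : SL2Z := Sub 1%:M SL2Z_one_subproof.
Definition SL2Z_mul A B : SL2Z := Sub (val A *m val B) (SL2Z_mul_subproof A B).
Definition SL2Z_inv A : SL2Z := Sub (invmx (val A)) (SL2Z_inv_subproof A).

Fact SL2Z_mulA : associative SL2Z_mul.
Proof. by move=> A B C; apply: val_inj; rewrite /= mulmxA. Qed.
Fact SL2Z_mul1 : left_id SL2Z_one SL2Z_mul.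
Proof. by move=> A; apply: val_inj; rewrite /= mul1mx. Qed.
Fact SL2Z_mulr1 : right_id SL2Z_one SL2Z_mul.
Proof. by move=> A; apply: val_inj; rewrite /= mulmx1. Qed.
Fact SL2Z_mulV : left_inverse SL2Z_one SL2Z_inv SL2Z_mul.
Proof. by move=> A; apply: val_inj; rewrite /= mulVmx// SL2Z_unitmx. Qed.
Fact SL2Z_mulrV : right_inverse SL2Z_one SL2Z_inv SL2Z_mul.
Proof. by move=> A; apply: val_inj; rewrite /= mulmxV// SL2Z_unitmx. Qed.

HB.instance Definition _ := isGroup.Build SL2Z
  SL2Z_mulA SL2Z_mul1 SL2Z_mulr1 SL2Z_mulV SL2Z_mulrV.

End SL2Z.

Section SemidirectProduct.
Variable G : groupClosed SL2Z.

(* The pair (g, u) stands for the product u g, with u in the normal factor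
   Z^2, so that (1, u) ^ (g, 0)^-1 = (1, g u). *)
Definition semidirect : Type := (subgroup_type G * 'cV[int]_2)%type.

HB.instance Definition _ := Choice.on semidirect.

Implicit Types p q : semidirect.

Definition semidirect_one : semidirect := (1%g, 0).
Definition semidirect_mul p q : semidirect :=
  ((p.1 * q.1)%g, p.2 + val (val p.1) *m q.2).
Definition semidirect_inv p : semidirect :=
  (p.1^-1%g, - (val (val p.1^-1%g) *m p.2)).

Fact semidirect_mulA : associative semidirect_mul.
Proof.
move=> p q r; rewrite /semidirect_mul /= mulgA; congr pair.
by rewrite mulmxDr addrA mulmxA.
Qed.
Fact semidirect_mul1 : left_id semidirect_one semidirect_mul.
Proof.
by move=> [g u]; rewrite /semidirect_mul /= mul1g mul1mx add0r.
Qed.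
Fact semidirect_mulr1 : right_id semidirect_one semidirect_mul.
Proof.
by move=> [g u]; rewrite /semidirect_mul /= mulg1 mulmx0 addr0.
Qed.
Fact semidirect_mulV :
  left_inverse semidirect_one semidirect_inv semidirect_mul.
Proof.
by move=> [g u]; rewrite /semidirect_mul /semidirect_inv /= mulVg addNr.
Qed.
Fact semidirect_mulrV :
  right_inverse semidirect_one semidirect_inv semidirect_mul.
Proof.
move=> [g u]; rewrite /semidirect_mul /semidirect_inv /= mulgV mulmxN.
by rewrite mulmxA mulmxV ?SL2Z_unitmx// mul1mx subrr.
Qed.

HB.instance Definition _ := isGroup.Build semidirect semidirect_mulA
  semidirect_mul1 semidirect_mulr1 semidirect_mulV semidirect_mulrV.

End SemidirectProduct.

Section Circle.
Variable R : realType.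

Definition circle_rel : rel R := fun x y => x - y \is a Num.int.

Fact circle_rel_equiv : equiv_class_of circle_rel.
Proof.
split=> [x|x y|y x z xy yz]; rewrite /circle_rel.
- by rewrite subrr rpred0.
- by rewrite -[y - x]opprB rpredN.
- by rewrite -[x](subrK y) -addrA rpredD.
Qed.

Canonical circle_equiv := EquivRelPack circle_rel_equiv.

(* S^1 = R/Z *)
Definition circle : Type := {eq_quot circle_equiv}%qT.

HB.instance Definition _ := Choice.on circle.

Definition circle_proj (x : R) : circle := (\pi_({eq_quot circle_equiv}) x)%qT.

Lemma circle_projP x y : circle_proj x = circle_proj y <-> x - y \is a Num.int.
Proof. by split=> [/eqP|xy]; [|apply/eqP]; rewrite /circle_proj eqmodE. Qed.

Lemma circle_projW (P : circle -> Prop) :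
  (forall x, P (circle_proj x)) -> forall z, P z.
Proof. by move=> h; elim/quotW => x; exact: h. Qed.

Definition C1 (F : R -> R) : Prop :=
  (forall x, derivable F x 1) /\ continuous (derive1 F).

(* The charts of R/Z are the local inverses of the projection R -> R/Z; [F]
   expresses [f] in such charts around the class of [x]. *)
Definition local_lift (F : R -> R) (f : circle -> circle) (x : R) : Prop :=
  \forall t \near x, f (circle_proj t) = circle_proj (F t).

(* A chart expression that is C^1 around [x] agrees near [x] with a C^1
   function on the whole of R, so asking for [C1 F] loses nothing. *)
Definition circle_C1 (f : circle -> circle) : Prop :=
  forall x, exists F, C1 F /\ local_lift F f x.

(* [F] is determined near [x] up to an integer constant, hence so is the sign
   of its derivative. *)
Definition orientation_preserving (f : circle -> circle) : Prop :=
  forall x, exists F, [/\ C1 F, local_lift F f x & 0 < derive1 F x].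

(* Diff^1_+(S^1) *)
Record diff1p : Type := Diff1p {
  diff1p_fun :> circle -> circle;
  diff1p_inv : circle -> circle;
  diff1p_funK : cancel diff1p_fun diff1p_inv;
  diff1p_invK : cancel diff1p_inv diff1p_fun;
  diff1p_C1 : circle_C1 diff1p_fun;
  diff1p_inv_C1 : circle_C1 diff1p_inv;
  diff1p_orient : orientation_preserving diff1p_fun }.

Lemma diff1p_ext (f g : diff1p) : diff1p_fun f = diff1p_fun g -> f = g.
Proof.
case: f g => [f f' fK f'K f1 f'1 fo] [g g' gK g'K g1 g'1 go] /= fg.
subst g; have ff' : f' = g'.
  by apply/funext => x; rewrite -[x in LHS]g'K fK.
by subst g'; congr Diff1p; exact: Prop_irrelevance.
Qed.

HB.instance Definition _ := gen_eqMixin diff1p.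
HB.instance Definition _ := gen_choiceMixin diff1p.

Lemma C1_continuous (F : R -> R) : C1 F -> continuous F.
Proof.
by move=> [dF _] x; apply/differentiable_continuous/derivable1_diffP.
Qed.

Lemma C1_id : C1 id.
Proof.
split=> [x|]; first exact: derivable_id.
have -> : derive1 (@id R) = cst 1.
  by apply/funext => x; rewrite derive1E derive_id.
by move=> x; exact: cst_continuous.
Qed.

Lemma C1_comp (F H : R -> R) : C1 F -> C1 H -> C1 (F \o H).
Proof.
move=> CF CH; have [[dF cF] [dH cH]] := (CF, CH); split.
  move=> x; apply/derivable1_diffP/differentiable_comp;
  exact/derivable1_diffP.
have -> : derive1 (F \o H) = (derive1 F \o H) \* derive1 H.
  by apply/funext => x; rewrite derive1_comp.
move=> x; apply: continuousM; last exact: cH.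
by apply: continuous_comp; [exact: C1_continuous | exact: cF].
Qed.

Lemma local_lift_comp F H f h x : continuous H ->
  local_lift F f (H x) -> local_lift H h x -> local_lift (F \o H) (f \o h) x.
Proof.
move=> cH Ff Hh; have FfH := cH x _ Ff.
near=> t; rewrite /= (near Hh t)//; near: t; exact: FfH.
Unshelve. all: end_near. Qed.

Lemma circle_C1_id : circle_C1 id.
Proof. by move=> x; exists id; split; [exact: C1_id | exact: filterE]. Qed.

Lemma circle_C1_comp f g : circle_C1 f -> circle_C1 g -> circle_C1 (f \o g).
Proof.
move=> Cf Cg x; have [G [CG Gg]] := Cg x; have [F [CF Ff]] := Cf (G x).
exists (F \o G); split; first exact: C1_comp.
by apply: local_lift_comp => //; exact: C1_continuous.
Qed.

Lemma orientation_preserving_id : orientation_preserving id.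
Proof.
move=> x; exists id; split; [exact: C1_id | exact: filterE |].
by rewrite derive1E derive_id.
Qed.

Lemma orientation_preserving_comp f g : orientation_preserving f ->
  orientation_preserving g -> orientation_preserving (f \o g).
Proof.
move=> Cf Cg x; have [G [CG Gg G0]] := Cg x.
have [F [CF Ff F0]] := Cf (G x).
exists (F \o G); split; first exact: C1_comp.
- by apply: local_lift_comp => //; exact: C1_continuous.
- by rewrite derive1_comp ?mulr_gt0//; [exact: CG.1 | exact: CF.1].
Qed.

Lemma local_lift_id_derive1 (F : R -> R) x :
  continuous F -> local_lift F id x -> derive1 F x = 1.
Proof.
move=> cF Fid; pose D t := F t - t.
have cD : D t @[t --> x] --> D x by apply: cvgB; [exact: cF | exact: cvg_id].
have D1 : \forall t \near x, `|D x - D t| < 1.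
  by have /cvgrPdist_lt/(_ _ ltr01) := cD.
have Fx := nbhs_singleton Fid.
have DE : {near x, F =1 (fun t => t + D x)}.
  near=> t; have Dint : D x - D t \is a Num.int.
    have Dx : D x \is a Num.int by apply/circle_projP; rewrite -Fx.
    by apply: rpredB => //; apply/circle_projP; rewrite -(near Fid t).
  have /eqP : D x - D t = 0.
    have : `|D x - D t| < 1 by near: t.
    have /intrP[k ->] := Dint; rewrite -intr_norm -[1]/(1%:~R) ltr_int.
    by move=> k1; have -> : k = 0 by lia.
  by rewrite subr_eq0 => /eqP ->; rewrite /D addrC subrK.
rewrite derive1E (near_eq_derive _ DE)// deriveD//.
by rewrite derive_id derive_cst addr0.
Unshelve. all: end_near. Qed.

Lemma orientation_preserving_inv (f g : circle -> circle) :
  cancel g f -> circle_C1 g -> orientation_preserving f ->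
  orientation_preserving g.
Proof.
move=> gK Cg Of x; have [G [CG Gg]] := Cg x; exists G; split=> //.
have [F [CF Ff F0]] := Of (G x).
have cFG : continuous (F \o G) by apply/C1_continuous/C1_comp.
have FG : local_lift (F \o G) id x.
  have -> : id = f \o g by apply/funext => z; rewrite /= gK.
  by apply: local_lift_comp => //; exact: C1_continuous.
have := local_lift_id_derive1 cFG FG; rewrite derive1_comp.
- by move=> E; rewrite -(pmulr_rgt0 _ F0) E.
- exact: CG.1.
- exact: CF.1.
Qed.

Implicit Types f g h : diff1p.

Definition diff1p_one : diff1p := Diff1p (fun=> erefl) (fun=> erefl)
  circle_C1_id circle_C1_id orientation_preserving_id.

Definition diff1p_comp f g : diff1p := Diff1p
  (can_comp (diff1p_funK f) (diff1p_funK g))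
  (can_comp (diff1p_invK g) (diff1p_invK f))
  (circle_C1_comp (diff1p_C1 f) (diff1p_C1 g))
  (circle_C1_comp (diff1p_inv_C1 g) (diff1p_inv_C1 f))
  (orientation_preserving_comp (diff1p_orient f) (diff1p_orient g)).

Definition diff1p_inverse f : diff1p := Diff1p
  (diff1p_invK f) (diff1p_funK f) (diff1p_inv_C1 f) (diff1p_C1 f)
  (orientation_preserving_inv (diff1p_invK f) (diff1p_inv_C1 f)
     (diff1p_orient f)).

Fact diff1p_compA : associative diff1p_comp.
Proof. by move=> f g h; exact: diff1p_ext. Qed.
Fact diff1p_comp1 : left_id diff1p_one diff1p_comp.
Proof. by move=> f; exact: diff1p_ext. Qed.
Fact diff1p_compr1 : right_id diff1p_one diff1p_comp.
Proof. by move=> f; exact: diff1p_ext. Qed.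
Fact diff1p_compV : left_inverse diff1p_one diff1p_inverse diff1p_comp.
Proof.
by move=> f; apply: diff1p_ext; apply/funext => x; exact: diff1p_funK.
Qed.
Fact diff1p_comprV : right_inverse diff1p_one diff1p_inverse diff1p_comp.
Proof.
by move=> f; apply: diff1p_ext; apply/funext => x; exact: diff1p_invK.
Qed.

HB.instance Definition _ := isGroup.Build diff1p
  diff1p_compA diff1p_comp1 diff1p_compr1 diff1p_compV diff1p_comprV.

End Circle.

(* Main.v *)
From HB Require Import structures.
Require Import Defs.
From mathcomp Require Import all_boot all_order all_algebra.
From mathcomp Require Import all_classical all_reals all_analysis.
From mathcomp Require Import zify ring lra.

Set Implicit Arguments.
Unset Strict Implicit.
Unset Printing Implicit Defensive.

Import Order.TTheory GRing.Theory Num.Theory.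
Import numFieldNormedType.Exports.

Local Open Scope classical_set_scope.
Local Open Scope ring_scope.

(** The group Z^2 is denoted A, and G acts on it by matrices.

A non-solvable G contains two hyperbolic matrices X and Y (of trace larger
than 2 in absolute value) without a common eigenvector, which is expressed by
det (X Y - Y X) <> 0 ([nonsolvable_hyperbolic_pair]). Everything is then
derived from X and Y.

Diffeomorphisms are lifted to the line ([ex_lift]). Put k = det (X - 1), which
is not 0. Every element of k A is of the form X b - b, so that it acts by a
commutator of the action of X with an element commuting with it; the lift of
this commutator has a fixed point, for otherwise its iterates would have a
linear drift ([commutator_fixed_point]). Commuting lifts with fixed points
have a common one, so that k A acts on the line with a global fixed point, and
the lifts of the elements of G normalise this action
([embedding_plane_action], [embedding_normalizes]).

Let I be a component of the complement of the set of global fixed points. On I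
the orbits of A order A, and Hoelder's theorem ([hoelder_embedding]) turns
this order into a translation number tau from A to the reals, which is not 0
and is unique up to a positive factor.

The heart of the matter is that, for a hyperbolic h in G, some iterate of the
lift H of h preserves I modulo an integral translation
([hyperbolic_not_wandering]). Otherwise the images of I under the iterates of
H are disjoint in the circle, so that their lengths tend to 0. On short
components the derivative of a fixed element a of A is close to 1, and that of
H is nearly constant; this is where C^1 regularity is used. Therefore the 2^n
elements sum_(i < n) e_i h^i a, where e_i is 0 or 1, contract the
subintervals of I at most by a factor of the order of (3/4) ^ n. But the
numbers tau (h^i a) grow like the powers of an eigenvalue, at least for h or
for its inverse, so that these 2^n elements move some fixed interval to
disjoint intervals; as 2 * 3/4 > 1, there is no room for all of them.

Consequently a power of h preserves the sign of tau, hence the line spanned by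
tau, and tau is an eigenvector of h ([slope_eigenvector]). This applies to
both X and Y, which have no common eigenvector. *)

(** * Functions on the line *)

Section RealAnalysis.
Variable R : realType.
Implicit Types F G phi : R -> R.

Lemma derivable_MVT F (x y : R) : (forall z, derivable F z 1) -> x < y ->
  exists2 z, x < z < y & F y - F x = derive1 F z * (y - x).
Proof.
move=> dF xy; have cF z : {for z, continuous F}.
  by apply/differentiable_continuous/derivable1_diffP.
have dF1 z : z \in `]x, y[ -> is_derive z 1 F (derive1 F z).
  by move=> _; split; [exact: dF | rewrite derive1E].
have [|z] := MVT xy dF1.
  by apply: continuous_subspaceT => z; exact: cF.
by rewrite in_itv /=; exists z.
Qed.

Lemma derive1_sub F G (x : R) : derivable F x 1 -> derivable G x 1 ->
  derivable (fun y => F y - G y) x 1 /\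
  derive1 (fun y => F y - G y) x = derive1 F x - derive1 G x.
Proof.
move=> dF dG; split; first by have h := derivableB dF dG; exact: h.
by have h := deriveB dF dG; rewrite !derive1E -h.
Qed.

Lemma derive1_addc F (c x : R) : derivable F x 1 ->
  derivable (fun y => F y + c) x 1 /\
  derive1 (fun y => F y + c) x = derive1 F x.
Proof.
move=> dF; have dc : derivable (cst c : R -> R) x 1 by exact: derivable_cst.
split; first by have h := derivableD dF dc; exact: h.
have h := deriveD dF dc; rewrite !derive1E; rewrite derive_cst addr0 in h; exact: h.
Qed.

(** Primitives on ]-n, oo[ differ by constants, so that normalising them at 0
makes them agree and gives a primitive on the whole line. *)
Lemma glue_primitives phi (P : nat -> R -> R) :
  (forall n x, - n%:R < x -> derivable (P n) x 1 /\ derive1 (P n) x = phi x) ->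
  exists F, forall x, derivable F x 1 /\ derive1 F x = phi x.
Proof.
move=> dP.
have PE (m n : nat) (x : R) : - m%:R < x -> - n%:R < x ->
    - m%:R < 0 :> R -> - n%:R < 0 :> R ->
    P m x - P m 0 = P n x - P n 0.
  move=> mx nx m0 n0; apply/eqP; rewrite -subr_eq0; apply/eqP.
  pose D y := P m y - P n y.
  have dD (y : R) : - m%:R < y -> - n%:R < y -> is_derive y 1 D 0.
    move=> my ny; have [d1 e1] := dP m _ my; have [d2 e2] := dP n _ ny.
    have [d e] := derive1_sub d1 d2; split=> //.
    by rewrite -derive1E e e1 e2 subrr.
  have D0 (u v : R) : u < v -> - m%:R < u -> - n%:R < u -> D v = D u.
    move=> uv mu nu; apply/eqP; rewrite -subr_eq0; apply/eqP.
    have lt (w z : R) : w < u -> z \in `[u, v] -> w < z.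
      by move=> wu; rewrite in_itv /= => /andP[+ _]; exact: lt_le_trans.
    have dz (z : R) : z \in `[u, v] -> is_derive z 1 D 0.
      by move=> zuv; apply: dD; exact: lt zuv.
    have dz' (z : R) : z \in `]u, v[ -> is_derive z 1 D 0.
      by move=> zuv; apply: dz; apply: subset_itv_oo_cc zuv.
    have [|z _ ->] := MVT uv dz'; last by rewrite mul0r.
    apply: derivable_within_continuous => z zuv; have := dz z zuv.
    by case.
  have -> : P m x - P m 0 - (P n x - P n 0) = D x - D 0 by rewrite /D; ring.
  case: (ltgtP x 0) => [x0|x0|->]; last by rewrite subrr.
    by rewrite (D0 x 0)// subrr.
  by rewrite (D0 0 x)// subrr.
(* a left end point that is valid for all points at distance < 1 of [x] *)
pose N (x : R) := (Num.truncn `|x|).+2.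
exists (fun x => P (N x) x - P (N x) 0) => x.
have NE (y : R) : `|x - y| < 1 -> - (N x)%:R < y.
  move=> xy; have : `|x| < (Num.truncn `|x|).+1%:R by exact: truncnS_gt.
  rewrite /N -[in X in X -> _]natr1 -[(_.+2)%:R]natr1 -[(_.+1)%:R]natr1.
  move: xy; rewrite !ltr_norml => /andP[_ xy] /andP[xN _].
  set t := _%:R in xN *; lra.
have Ny (y : R) : - (N y)%:R < y.
  have : `|y| < (Num.truncn `|y|).+1%:R by exact: truncnS_gt.
  rewrite ltr_norml => /andP[+ _]; apply: lt_trans.
  by rewrite ltrN2 ltr_nat.
have N0 (y : R) : - (N y)%:R < 0 :> R by rewrite oppr_lt0 ltr0n.
have near1 : \forall y \near x, P (N y) y - P (N y) 0 = P (N x) y - P (N x) 0.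
  near=> y; apply: PE => //; apply: NE.
  by near: y; have := @cvg_id _ (nbhs x) => /cvgrPdist_lt/(_ 1 ltr01).
have [d e] := dP (N x) x (Ny x).
have [dc ec] := derive1_addc (- P (N x) 0) d.
have near2 : {near x, (fun y => P (N x) y - P (N x) 0) =1
    (fun y => P (N y) y - P (N y) 0)} by apply: filterS near1 => y ->.
split; first exact: near_eq_derivable dc.
by rewrite derive1E -(near_eq_derive _ near2) -derive1E ec.
Unshelve. all: end_near. Qed.

Lemma continuous_primitive phi : continuous phi ->
  exists F, forall x, derivable F x 1 /\ derive1 F x = phi x.
Proof.
move=> cphi.
apply: (@glue_primitives phi (fun n x =>
  \int[lebesgue_measure]_(t in `[- (n%:R : R), x]) phi t)) => n x nx.
apply: (@continuous_FTC1_closed R phi _ _ (x + 1)) => //.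
- by rewrite ltrDl.
- apply: continuous_compact_integrable; first exact: segment_compact.
  exact: continuous_subspaceT.
- exact: cphi.
Qed.

End RealAnalysis.

(** * Lifts of circle diffeomorphisms *)

Section Lifts.
Variable R : realType.
Implicit Types (F G : R -> R) (f g : diff1p R).

Lemma locally_constantP (T : Type) (D : R -> T) :
  (forall x, \forall y \near x, D y = D x) -> forall x y, D x = D y.
Proof.
move=> Dloc x y; pose U := [set z | D z = D x].
have oU (V : set T) : open [set z | V (D z)].
  rewrite openE => z /= Vz; apply: filterS (Dloc z) => t Dt.
  by have : V (D t); [rewrite Dt | ].
have cT : connected [set: R] by apply/connected_intervalP => a b _ _ c _.
suff : U = [set: R] by move=> UT; have : [set: R] y by []; rewrite -UT => ->.
apply: cT; first by exists x.
  by exists U; [exact: (oU [set t | t = D x]) | rewrite setTI].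
exists U; last by rewrite setTI.
by rewrite -openC; exact: (oU [set t | t <> D x]).
Qed.

Lemma near_int_constant (D : R -> R) x : {for x, continuous D} ->
  (\forall y \near x, D y \is a Num.int) -> \forall y \near x, D y = D x.
Proof.
move=> cD Dint.
have D1 : \forall t \near x, `|D x - D t| < 1.
  by have /cvgrPdist_lt/(_ _ ltr01) := cD.
have Dx := nbhs_singleton Dint.
near=> t; have tint : D x - D t \is a Num.int.
  by apply: rpredB => //; near: t.
have : `|D x - D t| < 1 by near: t.
have /intrP[k Ek] := tint; rewrite Ek -intr_norm -[1]/(1%:~R) ltr_int => k1.
have k0 : k = 0 by lia.
by apply/eqP; rewrite eq_sym -subr_eq0 Ek k0.
Unshelve. all: end_near. Qed.

Lemma int_valued_constant (D : R -> R) : continuous D ->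
  (forall x, D x \is a Num.int) -> forall x y, D x = D y.
Proof.
move=> cD Dint; apply: locally_constantP => x.
by apply: near_int_constant; [exact: cD | exact: filterE].
Qed.

(** Lifts to the line of orientation-preserving C^1 diffeomorphisms of R/Z. *)
Definition circle_map F :=
  [/\ C1 F, forall x, 0 < derive1 F x & forall x, F (x + 1) = F x + 1].

Definition lifts F (f : circle R -> circle R) :=
  circle_map F /\ forall x, f (circle_proj x) = circle_proj (F x).

Lemma circle_map_continuous F : circle_map F -> continuous F.
Proof. by case=> /C1_continuous. Qed.

Lemma pos_derive1_lt F : (forall x, derivable F x 1) ->
  (forall x, 0 < derive1 F x) -> {homo F : x y / x < y}.
Proof.
move=> dF F0 x y xy; have [z _ E] := derivable_MVT dF xy.
by rewrite -subr_gt0 E mulr_gt0// subr_gt0.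
Qed.

Lemma circle_map_le F : circle_map F -> {mono F : x y / x <= y}.
Proof. by case=> [[dF _] F0 _]; apply: le_mono; exact: pos_derive1_lt. Qed.

Lemma circle_map_lt F : circle_map F -> {mono F : x y / x < y}.
Proof. by move=> /circle_map_le /leW_mono. Qed.

(** The difference of two local lifts is continuous and integer-valued. *)
Lemma local_lift_derive1 F G (f : circle R -> circle R) (x : R) :
  C1 F -> C1 G -> local_lift F f x -> local_lift G f x ->
  derive1 F x = derive1 G x.
Proof.
move=> CF CG Ff Gf; pose D (y : R) := F y - G y.
have near1 : {near x, D =1 cst (D x)}.
  apply: near_int_constant.
    by apply: continuousB; exact: C1_continuous.
  near=> y; apply/circle_projP; rewrite -(near Ff y)// -(near Gf y)//.
have [_ E] := derive1_sub (CF.1 x) (CG.1 x).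
apply/eqP; rewrite -subr_eq0 -E derive1E (near_eq_derive _ near1).
by rewrite derive_cst.
Unshelve. all: end_near. Qed.

Lemma circle_proj_addz (x : R) (m : int) :
  circle_proj (x + m%:~R) = circle_proj x :> circle R.
Proof. by apply/circle_projP; rewrite addrAC subrr add0r intr_int. Qed.

(** By [local_lift_derive1] the derivative of [f] is a well-defined continuous
function on the line. A primitive of it differs from every local lift of [f] by
a locally constant function, so that it lifts [f] everywhere as soon as it does
at one point. Its increment over a period is a positive integer, and it is 1
because [f] is injective. *)
Lemma ex_lift f : exists F, lifts F f.
Proof.
have [L LP] := choice (diff1p_orient f).
pose phi x := derive1 (L x) x.
have near_lift F x : local_lift F f x -> \forall y \near x, local_lift F f y.
  by move=> h; exact: near_join h.
have phiE F x : C1 F -> local_lift F f x -> phi x = derive1 F x.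
  move=> CF Ff; have [CL Lf _] := LP x.
  exact: local_lift_derive1 CL CF Lf Ff.
have cphi : continuous phi.
  move=> x; have [CL Lf _] := LP x.
  have E : {near x, derive1 (L x) =1 phi}.
    apply: filterS (near_lift _ _ Lf) => y Lfy.
    by rewrite (phiE (L x) y).
  apply: cvg_trans (near_eq_cvg E) _.
  by rewrite /= -[phi x]/(derive1 (L x) x); exact: CL.2.
have [P PP] := continuous_primitive cphi.
have CP : C1 P.
  split; first by move=> x; exact: (PP x).1.
  by have -> : derive1 P = phi by apply/funext => x; exact: (PP x).2.
have P0 x : 0 < derive1 P x by rewrite (PP x).2; have [] := LP x.
pose c := L 0 0 - P 0; pose F x := P x + c.
have dF x : derivable F x 1 /\ derive1 F x = phi x.
  have [dP eP] := PP x; have [dPc ePc] := derive1_addc c dP.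
  by split=> //; rewrite ePc.
have CF : C1 F.
  split; first by move=> x; exact: (dF x).1.
  by have -> : derive1 F = phi by apply/funext => x; exact: (dF x).2.
have F0 x : 0 < derive1 F x by rewrite (dF x).2; have [] := LP x.
have nearE x : \forall y \near x, L x y - F y = L x x - F x.
  have [CL Lf _] := LP x.
  have /nbhs_ballP[e /= e0 Be] : \forall y \near x, derive1 (L x) y = phi y.
    by apply: filterS (near_lift _ _ Lf) => y Lfy; rewrite (phiE (L x) y).
  apply/nbhs_ballP; exists e => //= y xy.
  pose D z := L x z - F z.
  have dD z : derivable D z 1 /\ derive1 D z = derive1 (L x) z - derive1 F z.
    by apply: derive1_sub; [exact: CL.1 | exact: (dF z).1].
  have dD0 z : ball x e z -> derive1 D z = 0.
    by move=> xz; rewrite (dD z).2 Be// (dF z).2 subrr.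
  have {}dD z : derivable D z 1 by exact: (dD z).1.
  have : D y = D x; last by [].
  move: xy; rewrite /ball /= => xy.
  apply/eqP; rewrite -subr_eq0; apply/eqP.
  case: (ltgtP x y) => [lxy|lyx|->]; last by rewrite subrr.
    have [z zxy ->] := derivable_MVT dD lxy; rewrite dD0 ?mul0r//.
    rewrite /ball /= ltr_distlC; move: xy; rewrite ltr_distlC => /andP[h1 h2].
    by move: zxy => /andP[z1 z2]; apply/andP; split; lra.
  have [z zxy E] := derivable_MVT dD lyx; rewrite -opprB E dD0 ?mul0r ?oppr0//.
  rewrite /ball /= ltr_distlC; move: xy; rewrite ltr_distlC => /andP[h1 h2].
  by move: zxy => /andP[z1 z2]; apply/andP; split; lra.
have liftF x : f (circle_proj x) = circle_proj (F x).
  have loc (y : R) : \forall z \near y,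
      (f (circle_proj z) = circle_proj (F z)) = (f (circle_proj y) = circle_proj (F y)).
    have [CL Lf _] := LP y; have Ly := nbhs_singleton Lf.
    near=> z; have E : L y z - F z = L y y - F y by near: z; exact: nearE.
    have -> : f (circle_proj z) = circle_proj (L y z) by near: z; exact: Lf.
    by rewrite Ly; apply/propext; rewrite !circle_projP E.
  have [_ L0 _] := LP 0; rewrite (locally_constantP loc x 0).
  by rewrite (nbhs_singleton L0) /F /c addrC subrK.
have ltF := pos_derive1_lt CF.1 F0.
have cF := C1_continuous CF.
have Dint x : F (x + 1) - F x \is a Num.int.
  by apply/circle_projP; rewrite -!liftF (circle_proj_addz _ 1).
have cD : continuous (fun x : R => F (x + 1) - F x).
  move=> y; apply: (@continuousB _ _ _ (fun x : R => F (x + 1)) F); last exact: cF.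
  apply: (@continuous_comp _ _ _ (fun x : R => x + 1) F); last exact: cF.
  by apply: continuousD; [exact: cvg_id | exact: cst_continuous].
have Dcst x : F (x + 1) - F x = F 1 - F 0.
  by rewrite (int_valued_constant cD Dint x 0) add0r.
exists F; split=> //; split=> // x.
have /intrP[k Ek] := Dint 0; rewrite add0r in Ek.
suff k1 : k = 1 by rewrite -(subrK (F x) (F (x + 1))) Dcst Ek k1 addrC.
have k_gt0 : 0 < k by rewrite -(ltr0z R) -Ek subr_gt0 ltF.
(* otherwise some point of ]0, 1[ and 0 have the same image in the circle *)
suff k_lt2 : k < 2 by lia.
rewrite ltNge; apply/negP => k2.
have F01 : F 0 + 2 <= F 1 by rewrite -lerBrDl Ek -[2]/(2%:~R) ler_int.
have [|/=|y y01 Fy] := @IVT R F 0 1 (F 0 + 1) ler01.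
- exact: continuous_subspaceT.
- by rewrite ge_min le_max; apply/andP; split; apply/orP; [left|right]; lra.
have : y \is a Num.int.
  rewrite -[y]subr0; apply/circle_projP; apply: (can_inj (diff1p_funK f)).
  by rewrite !liftF Fy; exact: (circle_proj_addz _ 1).
move: y01 => /[swap] /intrP[m Em]; rewrite in_itv /= {}Em in Fy *.
rewrite (ler_int R 0) (ler_int R _ 1) => /andP[m0 m1].
have [Em|Em] : m = 0 \/ m = 1 by lia.
  by move: Fy; rewrite Em; lra.
by move: Fy F01; rewrite Em => ->; lra.
Unshelve. all: end_near. Qed.

End Lifts.

(** * Fixed points of lifts *)

Section LiftAlgebra.
Variable R : realType.
Implicit Types (F G U V W : R -> R) (f g : diff1p R).

Lemma circle_map_addz F x (m : int) : circle_map F ->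
  F (x + m%:~R) = F x + m%:~R.
Proof.
case=> _ _ F1; have nat1 (n : nat) y : F (y + n%:R) = F y + n%:R.
  by elim: n => [|n IH]; rewrite ?addr0// -!natr1 !addrA F1 IH.
case: (intP m) => [|n|n]; first by rewrite !addr0.
  exact: (nat1 n.+1 x).
by rewrite mulrNz -[in RHS](subrK n.+1%:R x) nat1 addrK.
Qed.

Lemma circle_map_id : circle_map (@id R).
Proof.
split=> [|x|x]; [exact: C1_id | | by []].
by rewrite derive1E derive_id.
Qed.

Lemma circle_map_comp F G : circle_map F -> circle_map G -> circle_map (F \o G).
Proof.
move=> [CF F0 F1] [CG G0 G1]; split; first exact: C1_comp.
  by move=> x; rewrite derive1_comp ?mulr_gt0//; [exact: CG.1|exact: CF.1].
by move=> x; rewrite /= G1 F1.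
Qed.

Lemma circle_map_iter F n : circle_map F -> circle_map (iter n F).
Proof.
move=> cF; elim: n => [|n IH]; first exact: circle_map_id.
exact: (circle_map_comp cF IH).
Qed.

Lemma circle_map_addr F (c : R) : circle_map F -> circle_map (fun x => F x + c).
Proof.
move=> [CF F0 F1].
have dFc x := derive1_addc c (CF.1 x); split.
- split=> [x|]; first exact: (dFc x).1.
  rewrite (_ : derive1 _ = derive1 F); first exact: CF.2.
  by apply/funext => x; exact: (dFc x).2.
- by move=> x; rewrite (dFc x).2.
- by move=> x; rewrite F1 addrAC.
Qed.

Lemma lifts_comp F G (f g : circle R -> circle R) :
  lifts F f -> lifts G g -> lifts (F \o G) (f \o g).
Proof.
move=> [cF Ff] [cG Gg]; split; first exact: circle_map_comp.
by move=> x; rewrite /= Gg Ff.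
Qed.

Lemma lifts_addz F (f : circle R -> circle R) (m : int) : lifts F f ->
  lifts (fun x => F x + m%:~R) f.
Proof.
move=> [cF Ff]; split; first exact: circle_map_addr.
by move=> x; rewrite Ff circle_proj_addz.
Qed.

Lemma lifts_unique F G (f : circle R -> circle R) : lifts F f -> lifts G f ->
  exists m : int, forall x, G x = F x + m%:~R.
Proof.
move=> [cF Ff] [cG Gf].
have Dint x : G x - F x \is a Num.int by apply/circle_projP; rewrite -Gf Ff.
have /intrP[m Em] := Dint 0; exists m => x.
rewrite -Em (@int_valued_constant _ (fun x => G x - F x) _ Dint 0 x).
  by rewrite addrC subrK.
by move=> y; apply: continuousB; exact: circle_map_continuous.
Qed.

Lemma lifts_inv F f : lifts F f ->
  exists F', [/\ lifts F' (diff1p_inv f), cancel F F' & cancel F' F].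
Proof.
move=> Ff; have [H Hf] := ex_lift (diff1p_inverse f).
have HFid : lifts (H \o F) id.
  rewrite (_ : id = diff1p_inv f \o f); first exact: lifts_comp.
  by apply/funext => z; rewrite /= diff1p_funK.
have idid : lifts (@id R) id by split; [exact: circle_map_id|].
have [m Em] := lifts_unique idid HFid.
have FK : cancel F (fun x => H x + (- m)%:~R).
  by move=> x; rewrite -[H _]/((H \o F) x) Em mulrNz addrK.
exists (fun x => H x + (- m)%:~R); split=> //; first exact: lifts_addz.
move=> x; have Fx := FK (H x + (- m)%:~R).
have [cH _] := Hf.
have iH : injective (fun x => H x + (- m)%:~R).
  by move=> a b /addIr /eqP; rewrite eq_le !(circle_map_le cH) -eq_le => /eqP.
exact: iH.
Qed.

Lemma circle_map_bounded F : circle_map F ->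
  exists C, forall x, `|F x - x| <= C.
Proof.
move=> cF; exists (`|F 0| + 1) => x.
have /andP[] := floor_itv x; set m := Num.floor x => mx xm.
rewrite intrD in xm.
have h1 : F m%:~R <= F x by rewrite (circle_map_le cF).
have h2 : F x < F (m%:~R + 1%:~R) by rewrite (circle_map_lt cF).
rewrite -[m%:~R]add0r (circle_map_addz _ _ cF) in h1.
rewrite circle_map_addz// -[m%:~R]add0r circle_map_addz// in h2.
have := ler_norm (F 0); have := ler_norm (- F 0); rewrite normrN => n1 n2.
rewrite ler_norml; apply/andP; split; lra.
Qed.

(** The displacement is periodic, so that it is bounded away from 0 when it
does not vanish. *)
Lemma no_fixed_point_displacement W : circle_map W -> (forall x, W x != x) ->
  exists2 d, 0 < d & (forall x, x + d <= W x) \/ (forall x, W x <= x - d).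
Proof.
move=> cW Wx; pose D (x : R) := W x - x.
have cD : continuous D.
  move=> y; apply: continuousB; last exact: cvg_id.
  exact: (circle_map_continuous cW).
have cnD : continuous (fun x => `|D x|).
  by move=> y; apply: continuous_comp; [exact: cD | exact: norm_continuous].
have [c _ minc] := @EVT_min R (fun x => `|D x|) 0 1 ler01 (continuous_subspaceT cnD).
have D0 x : 0 < `|D x| by rewrite normr_gt0 subr_eq0.
exists `|D c|; first exact: D0.
have Dc x : `|D c| <= `|D x|.
  have /andP[] := floor_itv x; set m := Num.floor x => mx xm.
  rewrite intrD in xm.
  have -> : D x = D (x - m%:~R).
    by rewrite /D -mulrNz circle_map_addz// mulrNz; ring.
  by apply: minc; rewrite in_itv /=; apply/andP; split; lra.
have sgn a b : D a < 0 -> 0 < D b -> False.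
  move=> Da Db.
  have [u [v [uv uvE]]] : exists u v,
      u <= v /\ Num.min (D u) (D v) <= 0 <= Num.max (D u) (D v).
    case: (leP a b) => ab.
      by exists a, b; split=> //; rewrite ge_min le_max (ltW Da) (ltW Db) orbT.
    by exists b, a; split; [exact: ltW|rewrite ge_min le_max (ltW Da) (ltW Db) orbT].
  have [z _ Dz] := IVT uv (continuous_subspaceT cD) uvE.
  by have := D0 z; rewrite Dz normr0 ltxx.
case: (ltgtP (D 0) 0) => Ds.
- right=> x; have := Dc x; have : D x < 0.
    by case: (ltgtP (D x) 0) => // [/(sgn _ _ Ds)//|E]; have := D0 x; rewrite E normr0 ltxx.
  by move=> Dx; rewrite [`|D x|]ltr0_norm// /D; set n := `|_|; lra.
- left=> x; have := Dc x; have : 0 < D x.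
    by case: (ltgtP (D x) 0) => // [/sgn /(_ Ds)//|E]; have := D0 x; rewrite E normr0 ltxx.
  by move=> Dx; rewrite [`|D x|]gtr0_norm// /D; set n := `|_|; lra.
- by have := D0 0; rewrite Ds normr0 ltxx.
Qed.

(** [W] is the commutator of [U] and [V]. If it had no fixed point its iterates
would drift linearly, while W ^ n = (U V ^ n U ^-1) V ^ -n stays at a bounded
distance from the identity. *)
Lemma commutator_fixed_point U V W : circle_map U -> circle_map V ->
    circle_map W -> (forall x, U (V x) = W (V (U x))) ->
  (forall x, W (V x) = V (W x)) -> exists x, W x = x.
Proof.
move=> cU cV cW UV WV; apply: contrapT => noW.
have Wx x : W x != x by apply/eqP => Wx; apply: noW; exists x.
have [d d0 Wd] := no_fixed_point_displacement cW Wx.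
have [C UC] := circle_map_bounded cU.
have WVn n x : W (iter n V x) = iter n V (W x).
  by elim: n => //= n IH; rewrite WV IH.
have UVn n x : U (iter n V x) = iter n W (iter n V (U x)).
  elim: n x => // n IH x; rewrite [in LHS]iterS UV IH.
  rewrite -[iter n.+1 W _]/(W (iter n W (iter n.+1 V (U x)))); congr (W _).
  rewrite iterS; elim: n {IH} (iter n V (U x)) => //= k IH y.
  by rewrite -IH WV.
pose K : int := Posz (Num.truncn C).+1.
have CK : C < K%:~R := truncnS_gt C.
have cVn n : circle_map (iter n V) by exact: circle_map_iter.
have Wbound n : `|iter n W (iter n V (U 0)) - iter n V (U 0)| <= K%:~R + K%:~R.
  rewrite -UVn; have := UC (iter n V 0); have := UC 0.
  rewrite subr0 !ler_norml => /andP[u1 u2] /andP[v1 v2].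
  have h1 : iter n V (U 0) <= iter n V (0 + K%:~R).
    by rewrite (circle_map_le (cVn n)); lra.
  have h2 : iter n V (0 + (- K)%:~R) <= iter n V (U 0).
    by rewrite (circle_map_le (cVn n)) mulrNz; lra.
  rewrite circle_map_addz// in h1; rewrite circle_map_addz// mulrNz in h2.
  by apply/andP; split; lra.
pose n := (Num.truncn ((K%:~R + K%:~R) / d)).+1.
have : (K%:~R + K%:~R) / d < n%:R := truncnS_gt _.
rewrite ltr_pdivrMr// => nd; have := Wbound n.
rewrite ler_norml => /andP[w1 w2]; set y := iter n V (U 0) in w1 w2.
case: Wd => Wd.
- have : y + n%:R * d <= iter n W y.
    elim: (n) => [|k IH]; first by rewrite mul0r addr0.
    by have := Wd (iter k W y); rewrite iterS -natr1 mulrDl mul1r; lra.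
  by lra.
- have : iter n W y <= y - n%:R * d.
    elim: (n) => [|k IH]; first by rewrite mul0r subr0.
    by have := Wd (iter k W y); rewrite iterS -natr1 mulrDl mul1r; lra.
  by lra.
Qed.

(** Two lifts of commuting maps commute up to a translation by an integer, and
a translation with a fixed point is trivial. *)
Lemma lifts_commute F G (f g : circle R -> circle R) : lifts F f -> lifts G g ->
  f \o g = g \o f -> forall x, F (G x) = G (F x).
Proof.
move=> Ff Gg fg; have FGf := lifts_comp Ff Gg; have GFf := lifts_comp Gg Ff.
rewrite fg in FGf; have [m Em] := lifts_unique GFf FGf.
have cT : circle_map (fun x : R => x + m%:~R).
  exact: circle_map_addr circle_map_id.
have TG x : G x + m%:~R = G (x + m%:~R) by rewrite circle_map_addz//; exact: Gg.1.
have [x /eqP] := commutator_fixed_point Ff.1 Gg.1 cT Em TG.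
rewrite addrC -subr_eq0 addrK => m0 y.
by have /= := Em y; rewrite (eqP m0) addr0.
Qed.

Lemma sup_invariant (S : set R) (U U' : R -> R) : has_sup S ->
  {homo U : x y / x <= y} -> {homo U' : x y / x <= y} ->
  cancel U U' -> cancel U' U ->
  (forall x, S x -> S (U x)) -> (forall x, S x -> S (U' x)) ->
  U (sup S) = sup S.
Proof.
move=> supS mU mU' UK U'K SU SU'.
have le (V V' : R -> R) : {homo V : x y / x <= y} -> cancel V' V ->
    (forall x, S x -> S (V' x)) -> sup S <= V (sup S).
  move=> mV V'K SV'; apply: ge_sup; first exact: supS.1.
  move=> y Sy; rewrite -(V'K y); apply: mV; apply: sup_upper_bound => //.
  exact: SV'.
apply/eqP; rewrite eq_le (le U U')// andbT.
by rewrite -[leRHS]U'K; apply: mU; exact: (le U' U).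
Qed.

Lemma inf_invariant (S : set R) (U U' : R -> R) : has_inf S ->
  {homo U : x y / x <= y} -> {homo U' : x y / x <= y} ->
  cancel U U' -> cancel U' U ->
  (forall x, S x -> S (U x)) -> (forall x, S x -> S (U' x)) ->
  U (inf S) = inf S.
Proof.
move=> infS mU mU' UK U'K SU SU'.
have le (V V' : R -> R) : {homo V : x y / x <= y} -> cancel V' V ->
    (forall x, S x -> S (V' x)) -> V (inf S) <= inf S.
  move=> mV V'K SV'; apply: lb_le_inf; first exact: infS.1.
  move=> y Sy; rewrite -(V'K y); apply: mV; apply: ge_inf => //; first exact: infS.2.
  exact: SV'.
apply/eqP; rewrite eq_le (le U U')//.
by rewrite -[leLHS]U'K; apply: mU; exact: (le U' U).
Qed.

(** The fixed points of [F] below a fixed point of [G] form a set invariant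
under both maps, whose supremum they both fix. *)
Lemma common_fixed_point F F' G G' : circle_map F -> circle_map F' ->
    circle_map G -> circle_map G' -> cancel F F' -> cancel F' F ->
    cancel G G' -> cancel G' G -> (forall x, F (G x) = G (F x)) ->
    (exists x, F x = x) -> (exists x, G x = x) ->
  exists x, F x = x /\ G x = x.
Proof.
move=> cF cF' cG cG' FK F'K GK G'K FG [p Fp] [q Gq].
pose S := [set y | F y = y /\ y <= q].
have Sq y : S y -> y <= q by case.
have mono (H : R -> R) : circle_map H -> {homo H : x y / x <= y}.
  by move=> cH x y; rewrite circle_map_le.
have supS : has_sup S.
  split; last by exists q.
  pose m : int := Num.floor (q - p).
  exists (p + m%:~R); split; first by rewrite circle_map_addz// Fp.
  have := floor_le (q - p); rewrite -/m; lra.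
exists (sup S); split.
- apply: (sup_invariant supS (mono _ cF) (mono _ cF') FK F'K) => x [Fx xq].
    by rewrite /S /= !Fx.
  by have F'x : F' x = x by [rewrite -{1}Fx FK]; rewrite /S /= F'x.
- apply: (sup_invariant supS (mono _ cG) (mono _ cG') GK G'K) => x [Fx xq].
    by split; [rewrite FG Fx | rewrite -Gq circle_map_le].
  split; last by rewrite -(circle_map_le cG) G'K Gq.
  by apply: (can_inj GK); rewrite -FG !G'K.
Qed.

(** A lift with a fixed point displaces every point by less than 1. *)
Lemma lifts_fixed_unique F G (f : circle R -> circle R) :
  lifts F f -> lifts G f -> (exists x, F x = x) -> (exists x, G x = x) ->
  F = G.
Proof.
move=> Ff Gf [p Fp] [q Gq]; have [m Em] := lifts_unique Ff Gf.
have [cF _] := Ff.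
have F_q : F q = q - m%:~R by rewrite -[q in RHS]Gq Em addrK.
have diff x y : x <= y -> y < x + 1 -> F x = x -> F y - y < 1 /\ y - F y < 1 .
  move=> xy yx Fx; have [_ _ F1] := cF.
  have h1 : F x <= F y by rewrite circle_map_le.
  have h2 : F y < F (x + 1) by rewrite circle_map_lt.
  by rewrite F1 in h2; split; lra.
have /andP[] := floor_itv (q - p); set k := Num.floor _ => k1 k2.
rewrite intrD in k2.
have [|||d1 d2] := diff (p + k%:~R) q.
- lra.
- lra.
- by rewrite circle_map_addz// Fp.
rewrite F_q in d1 d2.
have m1 : (m%:~R : R) < 1%:~R by lra.
have m2 : ((- m)%:~R : R) < 1%:~R by rewrite mulrNz; lra.
rewrite !ltr_int in m1 m2.
have m0 : m = 0 by lia.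
by apply/funext => x; rewrite Em m0 addr0.
Qed.

Lemma circle_map_derive1_addz F (x : R) (m : int) : circle_map F ->
  derive1 F (x + m%:~R) = derive1 F x.
Proof.
move=> cF; have [[dF _] _ _] := cF.
pose T (y : R) : R := y + m%:~R.
have [dT eT] : derivable T x 1 /\ derive1 T x = derive1 id x.
  exact: (derive1_addc m%:~R (@derivable_id _ _ x 1)).
have [_ <-] := derive1_addc m%:~R (dF x).
have FT : (fun y => F y + m%:~R) = F \o T.
  by apply/funext => y; rewrite /= circle_map_addz.
have h := derive1_comp dT (dF (T x)).
by rewrite FT h eT [derive1 id _]derive1E derive_id mulr1.
Qed.

(** Moving a point into [0, 1] turns compactness of that segment into
uniformity over the line. *)
Lemma circle_map_derive1_unif_continuous F : circle_map F -> forall e, 0 < e ->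
  exists2 d, 0 < d & forall x y, `|x - y| < d ->
    `|derive1 F x - derive1 F y| < e.
Proof.
move=> cF e e0; have [[dF cdF] _ _] := cF.
have /compact_near_coveringP /(_ R (0 : R)^'+
  (fun d x => forall y, `|x - y| < d -> `|derive1 F x - derive1 F y| < e)) :=
  @segment_compact R 0 1.
case.
  move=> x _; have /cvgrPdist_lt/(_ (e / 2)) := cdF x.
  case; first by rewrite divr_gt0.
  move=> r /= r0 rF; near=> x' d => y /= x'y.
  have xx' : `|x - x'| < r / 2.
    near: x'; have /cvgrPdist_lt := @cvg_id _ (nbhs x).
    by apply; rewrite divr_gt0.
  have dr : d < r / 2 by near: d; apply: nbhs_right_lt; rewrite divr_gt0.
  have Fx' : `|derive1 F x - derive1 F x'| < e / 2.
    apply: rF => /=; apply: lt_trans xx' _.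
    by rewrite ltr_pdivrMr// ltr_pMr// ltr1n.
  have Fy : `|derive1 F x - derive1 F y| < e / 2.
    apply: rF => /=; apply: le_lt_trans (ler_distD x' _ _) _.
    by rewrite [r]splitr ltrD// (lt_trans x'y).
  apply: le_lt_trans (ler_distD (derive1 F x) _ _) _.
  by rewrite [e]splitr ltrD// distrC.
move=> d0 /= d00 Hd; exists (d0 / 2); first by rewrite divr_gt0.
move=> x y xy; have /andP[] := floor_itv x; set m := Num.floor x => mx xm.
rewrite intrD in xm.
rewrite -(circle_map_derive1_addz x (- m))// -(circle_map_derive1_addz y (- m))//.
apply: (Hd (d0 / 2)) => /=.
- by rewrite sub0r normrN gtr0_norm ?divr_gt0//; lra.
- by rewrite divr_gt0.
- by rewrite mulrNz in_itv /=; apply/andP; split; lra.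
- by rewrite opprD addrACA subrr addr0.
Unshelve. all: end_near. Qed.

Lemma circle_map_derive1_lower_bound F : circle_map F ->
  exists2 m, 0 < m & forall x, m <= derive1 F x.
Proof.
move=> cF; have [[_ cdF] F0 _] := cF.
have [c _ minc] := EVT_min ler01 (continuous_subspaceT cdF).
exists (derive1 F c) => // x.
have /andP[] := floor_itv x; set m := Num.floor x => mx xm.
rewrite intrD in xm.
rewrite -(circle_map_derive1_addz x (- m))//; apply: minc.
by rewrite mulrNz in_itv /=; apply/andP; split; lra.
Qed.

End LiftAlgebra.

(** * Total preorders on abelian groups *)

Section Hoelder.
Variables (R : realType) (V : zmodType) (le : V -> V -> Prop) (c0 : V).
Hypothesis le_total : forall a b, le a b \/ le b a.
Hypothesis le_trans : forall b a c, le a b -> le b c -> le a c.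
Hypothesis le_add : forall c a b, le a b -> le (a + c) (b + c).
Hypothesis c0_pos : ~ le c0 0.
Hypothesis c0_arch : forall v, exists n : nat, le v (c0 *+ n).

Let le_refl a : le a a.
Proof. by case: (le_total a a). Qed.

Let leD a b c d : le a b -> le c d -> le (a + c) (b + d).
Proof.
move=> ab cd; apply: (le_trans (le_add c ab)).
by rewrite ![b + _]addrC; exact: le_add.
Qed.

Let leMn n a b : le a b -> le (a *+ n) (b *+ n).
Proof.
move=> ab; elim: n => [|n IH]; first by rewrite !mulr0n.
by rewrite !mulrS; exact: leD.
Qed.

Let leN a b : le a b -> le (- b) (- a).
Proof.
move=> /(le_add (- a - b)).
by rewrite addrA subrr add0r addrCA subrr addr0.
Qed.

Let c0_ge0 : le 0 c0.
Proof. by case: (le_total 0 c0). Qed.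

Let c0_mulz (p q : int) : le (c0 *~ p) (c0 *~ q) <-> (p <= q)%R.
Proof.
have mono (m n : int) : (m <= n)%R -> le (c0 *~ m) (c0 *~ n).
  move=> mn; have [k ->] : exists k : nat, n = m + k%:Z by exists `|n - m|%N; lia.
  rewrite mulrzDr -[X in le X _]addr0; apply: leD => //.
  by have := leMn k c0_ge0; rewrite mul0rn.
split; last exact: mono.
move=> pq; rewrite leNgt; apply/negP => qp; apply: c0_pos.
have : le (c0 *~ (q + 1)) (c0 *~ q) by apply: le_trans pq; apply: mono; lia.
by move=> /(le_add (- (c0 *~ q))); rewrite mulrzDr addrAC subrr add0r.
Qed.

(** Lower Dedekind cut of the ratio of [v] to the unit [c0]. *)
Let slopes v : set R :=
  [set s | exists p : int, exists2 q : nat, (0 < q)%N &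
    le (c0 *~ p) (v *+ q) /\ s = p%:~R / q%:R].

Definition hoelder_slope v : R := sup (slopes v).
Local Notation tau := hoelder_slope.

Let slope_le (v : V) (p p' : int) (q q' : nat) : (0 < q)%N -> (0 < q')%N ->
  le (c0 *~ p) (v *+ q) -> le (v *+ q') (c0 *~ p') ->
  p%:~R / q%:R <= p'%:~R / q'%:R :> R.
Proof.
move=> q0 q'0 lo up; rewrite ler_pdivrMr ?ltr0n// mulrAC ler_pdivlMr ?ltr0n//.
rewrite -[q%:R]/(q%:~R) -[q'%:R]/(q'%:~R) -!intrM ler_int -c0_mulz.
rewrite !mulrzA -!pmulrn.
apply: (le_trans (leMn q' lo)); rewrite -mulrnA mulnC mulrnA; exact: leMn.
Qed.

Let has_sup_slopes v : has_sup (slopes v).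
Proof.
have [n vn] := c0_arch v; have [m vm] := c0_arch (- v); split.
  exists ((- m%:Z)%:~R / 1%:R); exists (- m%:Z), 1%N => //; split=> //.
  by rewrite mulr1n mulrNz -pmulrn -[v]opprK; exact: leN.
exists (n%:Z%:~R / 1%:R) => s [p [q q0 [pq ->]]].
by apply: slope_le pq _ => //; rewrite mulr1n -pmulrn.
Qed.

Let slope_lb (v : V) (p : int) (q : nat) : (0 < q)%N ->
  le (c0 *~ p) (v *+ q) -> p%:~R / q%:R <= tau v.
Proof.
move=> q0 pq; apply: sup_upper_bound; first exact: has_sup_slopes.
by exists p, q.
Qed.

Let slope_ub (v : V) (p : int) (q : nat) : (0 < q)%N ->
  le (v *+ q) (c0 *~ p) -> tau v <= p%:~R / q%:R.
Proof.
move=> q0 pq; apply: ge_sup; first exact: (has_sup_slopes v).1.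
by move=> s [p' [q' q'0 [lo ->]]]; exact: slope_le lo pq.
Qed.

Lemma hoelder_slope_unit : tau c0 = 1.
Proof.
apply/eqP; rewrite eq_le -[1]divr1; apply/andP; split.
  by apply: (@slope_ub _ 1 1) => //; rewrite mulr1n mulr1z.
by apply: (@slope_lb _ 1 1) => //; rewrite mulr1n mulr1z.
Qed.

Lemma hoelder_slopeD v w : tau (v + w) = tau v + tau w.
Proof.
(* [q u] lies within one unit of an integral multiple of [c0]; errors add up
to a constant, which the division by [q] makes negligible *)
have approx u (q : nat) : (0 < q)%N -> exists p : int,
    [/\ le (c0 *~ (p - 1)) (u *+ q), le (u *+ q) (c0 *~ (p + 1)) &
        p%:~R <= tau u * q%:R < p%:~R + 1].
  move=> q0; exists (Num.floor (tau u * q%:R)).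
  have /andP[] := floor_itv (tau u * q%:R).
  set p := Num.floor _; rewrite intrD => p1 p2.
  have q0' : 0 < q%:R :> R by rewrite ltr0n.
  split; last by rewrite p1.
    case: (le_total (c0 *~ (p - 1)) (u *+ q)) => // /(slope_ub q0).
    by rewrite ler_pdivlMr// intrD mulrN1z; lra.
  case: (le_total (c0 *~ (p + 1)) (u *+ q)) => // /(slope_lb q0).
  by rewrite ler_pdivrMr// intrD; lra.
have close (q : nat) : (0 < q)%N ->
    `|tau (v + w) - (tau v + tau w)| * q%:R <= 4.
  move=> q0; have [p [lo up pv]] := approx v q q0.
  have [p' [lo' up' pw]] := approx w q q0.
  have q0' : 0 < q%:R :> R by rewrite ltr0n.
  have := leD lo lo'; rewrite -mulrzDr -mulrnDl => /(slope_lb q0).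
  have := leD up up'; rewrite -mulrzDr -mulrnDl => /(slope_ub q0).
  rewrite ler_pdivlMr// ler_pdivrMr// !intrD mulrN1z => h1 h2.
  move: pv pw => /andP[a1 a2] /andP[b1 b2].
  rewrite -[X in _ * X]ger0_norm ?ler0n// -normrM.
  set T := tau (v + w) in h1 h2 *; set a := tau v in a1 a2 *.
  set b := tau w in b1 b2 *.
  have -> : (T - (a + b)) * q%:R = T * q%:R - a * q%:R - b * q%:R by ring.
  by rewrite ler_norml; apply/andP; split; lra.
apply/eqP; rewrite -subr_eq0; set e := _ - _ in close *.
apply: contraPT (@truncnS_gt R (4 / `|e|)) => e0; apply/negP; rewrite -leNgt.
by rewrite ler_pdivlMr ?normr_gt0// mulrC; exact: close.
Qed.

Lemma hoelder_slope_le v w : le v w -> tau v <= tau w.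
Proof.
move=> vw; apply: ge_sup; first exact: (has_sup_slopes v).1.
move=> s [p [q q0 [lo ->]]]; apply: slope_lb => //.
by apply: le_trans lo _; exact: leMn.
Qed.

End Hoelder.

(** Hoelder's theorem, without injectivity: a total preorder with a strong unit
on an abelian group is read off, up to infinitesimals, by a real-valued
homomorphism. *)
Lemma hoelder_embedding (R : realType) (V : zmodType) (le : V -> V -> Prop)
    (c0 : V) :
  (forall a b, le a b \/ le b a) ->
  (forall b a c, le a b -> le b c -> le a c) ->
  (forall c a b, le a b -> le (a + c) (b + c)) ->
  ~ le c0 0 -> (forall v, exists n : nat, le v (c0 *+ n)) ->
  exists tau : V -> R, [/\ tau c0 = 1, {morph tau : v w / v + w} &
    forall v w, le v w -> tau v <= tau w].
Proof.
move=> tot tr ad c0p c0a; exists (hoelder_slope R le c0); split.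
- exact: hoelder_slope_unit.
- exact: hoelder_slopeD.
- by move=> v w; exact: hoelder_slope_le.
Qed.

(** * Hyperbolic elements of SL(2, Z) *)

Section Metabelian.
Variable gT : groupType.

Lemma derived_subgroup_min (H K : set gT) : is_subgroup K ->
  (forall x y, H x -> H y -> K [~ x, y]%g) -> derived_subgroup H `<=` K.
Proof.
move=> sK HK z; apply; split=> // _ [x Hx [y Hy <-]]; exact: HK.
Qed.

Lemma metabelian_solvable (C : set gT) : is_subgroup C ->
  (forall x y, C [~ x, y]%g) -> (forall x y, C x -> C y -> commute x y) ->
  solvable_group gT.
Proof.
move=> sC Cder Cab; exists 2%N; rewrite /= eqEsubset; split.
  apply: derived_subgroup_min.
    by split=> // x y -> ->; rewrite mulgV.
  move=> x y Dx Dy; have sub : derived_subgroup [set: gT] `<=` C.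
    by apply: derived_subgroup_min => // u v _ _; exact: Cder.
  exact/eqP/commgP/(Cab _ _ (sub _ Dx) (sub _ Dy)).
by move=> _ -> K [[K1 _] _].
Qed.

End Metabelian.

Section IntegerForms.
Implicit Types al b c be q r t : int.

(** A 2 x 2 matrix is represented by its difference [al] of diagonal entries
and its off-diagonal entries [b] and [c], a second one by [be], [q] and [r].
These are the entries of the commutator X Y - Y X, up to sign. *)
Definition cross1 b c q r := b * r - c * q.
Definition cross2 al b be q := al * q - b * be.
Definition cross3 al c be r := c * be - r * al.
(** This is - det (X Y - Y X). *)
Definition cross_form al b c be q r : int :=
  cross1 b c q r ^+ 2 + cross2 al b be q * cross3 al c be r.

Lemma hyperbolic_disc_not_square t (s : int) : 2 < `|t| -> s ^+ 2 != t ^+ 2 - 4.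
Proof.
move=> t3; apply/eqP => st.
have st' : `|s| ^+ 2 = `|t| ^+ 2 - 4 by rewrite !real_normK ?num_real.
move: st'; set u := `|s|; set v := `|t| in t3 *.
have u0 : 0 <= u by exact: normr_ge0.
move=> E; have uv : u < v by nia.
have [e|e] : u = v - 1 \/ u <= v - 2 by lia.
  by rewrite e in E; nia.
by nia.
Qed.

Lemma hyperbolic_disc_mul_square t (s w : int) : 2 < `|t| ->
  s ^+ 2 = (t ^+ 2 - 4) * w ^+ 2 ->
  w = 0.
Proof.
move=> t3 E; apply/eqP; apply/negPn/negP => w0.
have /dvdzP[k Ek] : (w %| s)%Z.
  by rewrite -(@dvdz_pexp2r _ _ 2)//; apply/dvdzP; exists (t ^+ 2 - 4).
have /eqP := E; rewrite Ek exprMn.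
by rewrite (inj_eq (mulIf _)) ?expf_neq0//; apply/negP; exact: hyperbolic_disc_not_square.
Qed.

Lemma cross_rel al b c be q r :
  b * cross3 al c be r = - al * cross1 b c q r - c * cross2 al b be q.
Proof. by rewrite /cross1 /cross2 /cross3; ring. Qed.

Lemma cross_form_square al b c be q r :
  (2 * b * cross1 b c q r - al * cross2 al b be q) ^+ 2 =
  (al ^+ 2 + 4 * b * c) * cross2 al b be q ^+ 2 +
  4 * b ^+ 2 * cross_form al b c be q r.
Proof. by rewrite /cross_form /cross1 /cross2 /cross3; ring. Qed.

(** Modulo [cross_form = 0], [cross_form_square] says that t^2 - 4 times a
square is a square; but t^2 - 4 is not a square when |t| > 2. *)
Lemma cross_form_hyperbolic al b c be q r t : 2 < `|t| ->
  al ^+ 2 + 4 * b * c = t ^+ 2 - 4 -> cross_form al b c be q r = 0 ->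
  [/\ cross1 b c q r = 0, cross2 al b be q = 0 & cross3 al c be r = 0].
Proof.
move=> t3 D cr0; have := cross_form_square al b c be q r.
rewrite cr0 mulr0 addr0 D => /(hyperbolic_disc_mul_square t3) F0.
have b0 : b != 0.
  apply/eqP => b0; move: D; rewrite b0 mulr0 mul0r addr0 => /eqP.
  by apply/negP; exact: hyperbolic_disc_not_square.
have E0 : cross1 b c q r = 0.
  by move: cr0; rewrite /cross_form F0 mul0r addr0 => /eqP; rewrite sqrf_eq0 => /eqP.
split=> //; apply: (mulfI b0).
by rewrite (cross_rel _ _ _ _ q) E0 F0 !mulr0 subr0.
Qed.

(** By [cross_rel], [b * cross_form] is the value at (cross1, cross2) of the
quadratic form b E^2 - al E F - c F^2, which has the sign of [b] when its
discriminant is nonpositive. *)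
Lemma cross_form_ge0 al b c be q r : al ^+ 2 + 4 * b * c <= 0 ->
  0 <= cross_form al b c be q r.
Proof.
move=> D; case: (eqVneq b 0) => [b0|b0].
  have al0 : al = 0 by move: D; rewrite b0; nia.
  have -> : cross_form al b c be q r = cross1 b c q r ^+ 2.
    by rewrite /cross_form /cross2 b0 al0; ring.
  exact: sqr_ge0.
have := cross_form_square al b c be q r.
set x := 2 * b * _ - _; set F := cross2 _ _ _ _; set C := cross_form _ _ _ _ _ _.
move=> E; have b2 : 0 < b ^+ 2 by rewrite lt0r sqrf_eq0 b0 sqr_ge0.
rewrite -(pmulr_rge0 _ b2).
have := sqr_ge0 x; have := sqr_ge0 F; nia.
Qed.

Lemma cross_form_sym al b c be q r :
  cross_form be q r al b c = cross_form al b c be q r.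
Proof. by rewrite /cross_form /cross1 /cross2 /cross3; ring. Qed.

Lemma cross_form_elliptic al b c be q r : al ^+ 2 + 4 * b * c < 0 ->
  cross_form al b c be q r = 0 ->
  [/\ cross1 b c q r = 0, cross2 al b be q = 0 & cross3 al c be r = 0].
Proof.
move=> D cr0; have b0 : b != 0 by apply/eqP => b0; move: D; rewrite b0; nia.
have := cross_form_square al b c be q r; rewrite cr0 mulr0 addr0.
set E := cross1 _ _ _ _; set F := cross2 _ _ _ _ => sq.
have F0 : F = 0.
  have := sqr_ge0 (2 * b * E - al * F); rewrite sq => h.
  apply/eqP; rewrite -sqrf_eq0; apply/eqP; have := sqr_ge0 F; nia.
have E0 : E = 0.
  by move: cr0; rewrite /cross_form -/F F0 mul0r addr0 => /eqP; rewrite sqrf_eq0 => /eqP.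
split=> //; apply: (mulfI b0).
by rewrite (cross_rel _ _ _ _ q) -/E -/F E0 F0 !mulr0 subr0.
Qed.

Lemma cross_form_parabolic al b c be q r : al ^+ 2 + 4 * b * c = 0 ->
  be ^+ 2 + 4 * q * r = 0 -> cross_form al b c be q r = 0 ->
  [/\ cross1 b c q r = 0, cross2 al b be q = 0 & cross3 al c be r = 0].
Proof.
move=> D1 D2 cr0.
(* the polar form of the discriminant, whose square is a multiple of
[cross_form] on two isotropic vectors *)
pose B := al * be + 2 * b * r + 2 * c * q.
have B0 : B = 0.
  apply/eqP; rewrite -sqrf_eq0; apply/eqP.
  have -> : B ^+ 2 = (al ^+ 2 + 4 * b * c) * (be ^+ 2 + 4 * q * r)
     + 4 * cross_form al b c be q r.
    by rewrite /B /cross_form /cross1 /cross2 /cross3; ring.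
  by rewrite D1 cr0 mul0r mulr0 addr0.
have F0 : cross2 al b be q = 0.
  apply/eqP; rewrite -sqrf_eq0; apply/eqP.
  have -> : cross2 al b be q ^+ 2 = q ^+ 2 * (al ^+ 2 + 4 * b * c) +
      b ^+ 2 * (be ^+ 2 + 4 * q * r) - 2 * b * q * B.
    by rewrite /cross2 /B; ring.
  by rewrite D1 D2 B0 !mulr0 subr0.
have G0 : cross3 al c be r = 0.
  apply/eqP; rewrite -sqrf_eq0; apply/eqP.
  have -> : cross3 al c be r ^+ 2 = r ^+ 2 * (al ^+ 2 + 4 * b * c) +
      c ^+ 2 * (be ^+ 2 + 4 * q * r) - 2 * c * r * B.
    by rewrite /cross3 /B; ring.
  by rewrite D1 D2 B0 !mulr0 subr0.
split=> //; move: cr0; rewrite /cross_form F0 mul0r addr0 => /eqP.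
by rewrite sqrf_eq0 => /eqP.
Qed.

Lemma parallel_same_disc al b c be q r : b != 0 ->
  al ^+ 2 + 4 * b * c != 0 -> be ^+ 2 + 4 * q * r = al ^+ 2 + 4 * b * c ->
  cross1 b c q r = 0 -> cross2 al b be q = 0 ->
  [/\ q = b, be = al & r = c] \/ [/\ q = - b, be = - al & r = - c].
Proof.
rewrite /cross1 /cross2 => b0 D0 D c1 c2.
have alq : al * q = b * be by lia.
have cq : c * q = b * r by lia.
have qb : q ^+ 2 = b ^+ 2.
  apply: (mulIf D0); rewrite -[in RHS]D.
  have -> : q ^+ 2 * (al ^+ 2 + 4 * b * c) = (al * q) ^+ 2 + 4 * b * q * (c * q).
    by ring.
  by rewrite alq cq; ring.
have [qE|qE] : q = b \/ q = - b.
  by move/eqP: qb; rewrite eqf_sqr => /orP[] /eqP; [left|right].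
  by left; split=> //; apply: (mulfI b0); rewrite ?(mulrC b al) ?(mulrC b c) -?alq -?cq qE.
right; split=> //; apply: (mulfI b0).
  by rewrite -alq qE; ring.
by rewrite -cq qE; ring.
Qed.

End IntegerForms.

Section TwoByTwo.
Variable S : comNzRingType.
Implicit Types A B : 'M[S]_2.

Lemma ord2P (i : 'I_2) : i = 0 \/ i = 1.
Proof. by case: i => [[|[|]]] // p; [left|right]; apply: val_inj. Qed.

Lemma eq_mx2 A B : A 0 0 = B 0 0 -> A 0 1 = B 0 1 -> A 1 0 = B 1 0 ->
  A 1 1 = B 1 1 -> A = B.
Proof.
move=> h00 h01 h10 h11; apply/matrixP => i j.
by case: (ord2P i) => ->; case: (ord2P j) => ->.
Qed.

Lemma sum_ord2 (F : 'I_2 -> S) : \sum_i F i = F 0 + F 1.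
Proof.
rewrite !big_ord_recl big_ord0 addr0; congr (_ + F _); exact: val_inj.
Qed.

Lemma mulmx2E n (A : 'M[S]_2) (B : 'M[S]_(2, n)) i j :
  (A *m B) i j = A i 0 * B 0 j + A i 1 * B 1 j.
Proof. by rewrite mxE sum_ord2. Qed.

Lemma det_mx2 A : \det A = A 0 0 * A 1 1 - A 0 1 * A 1 0.
Proof.
rewrite (expand_det_row _ 0) sum_ord2 /cofactor !det_mx11 !mxE /=.
rewrite expr0 expr1 mul1r mulN1r mulrN; congr (_ * A _ _ - _ * A _ _);
  exact: val_inj.
Qed.

End TwoByTwo.

Section SL2ZGeometry.
Implicit Types X Y Z : SL2Z.

Lemma SL2Z_det X :
  val X 0 0 * val X 1 1 - val X 0 1 * val X 1 0 = 1.
Proof. by rewrite -det_mx2; exact/eqP/(valP X). Qed.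

Lemma SL2Z_invE X : let A := val X in let B := val X^-1%g in
  [/\ B 0 0 = A 1 1, B 0 1 = - A 0 1, B 1 0 = - A 1 0 & B 1 1 = A 0 0].
Proof.
move=> A B; have D : A 0 0 * A 1 1 - A 0 1 * A 1 0 = 1 := SL2Z_det X.
have XV : A *m B = 1%:M by rewrite -[A *m B]/(val (X * X^-1)%g) mulgV.
have E i j : A i 0 * B 0 j + A i 1 * B 1 j = (i == j)%:R.
  by rewrite -mulmx2E XV mxE.
have e00 := E 0 0; have e01 := E 0 1; have e10 := E 1 0; have e11 := E 1 1.
rewrite /= in e00 e01 e10 e11.
move: (A 0 0) (A 0 1) (A 1 0) (A 1 1) D e00 e01 e10 e11 => a b c d D e00 e01 e10 e11.
have sol x y u v : a * x + b * y = u -> c * x + d * y = v ->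
    x = d * u - b * v /\ y = a * v - c * u.
  move=> <- <-; split.
    by rewrite -[LHS]mul1r -D; ring.
  by rewrite -[LHS]mul1r -D; ring.
have [-> ->] := sol _ _ _ _ e00 e10; have [-> ->] := sol _ _ _ _ e01 e11.
by rewrite !mulr1 !mulr0 !subr0 !sub0r.
Qed.

Definition hyperbolic X := 2 < `|\tr (val X)|.

Definition SL2Z_cross X Y :=
  cross_form (val X 0 0 - val X 1 1) (val X 0 1) (val X 1 0)
             (val Y 0 0 - val Y 1 1) (val Y 0 1) (val Y 1 0).

Lemma SL2Z_commuteP X Y : commute X Y <->
  [/\ cross1 (val X 0 1) (val X 1 0) (val Y 0 1) (val Y 1 0) = 0,
      cross2 (val X 0 0 - val X 1 1) (val X 0 1)
             (val Y 0 0 - val Y 1 1) (val Y 0 1) = 0 &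
      cross3 (val X 0 0 - val X 1 1) (val X 1 0)
             (val Y 0 0 - val Y 1 1) (val Y 1 0) = 0].
Proof.
rewrite /cross1 /cross2 /cross3; split=> [XY|[c1 c2 c3]].
  have E i j : (val X *m val Y) i j = (val Y *m val X) i j.
    by rewrite -[val X *m val Y]/(val (X * Y)%g) XY.
  have e00 := E 0 0; have e01 := E 0 1; have e10 := E 1 0.
  rewrite !mulmx2E in e00 e01 e10; move: e00 e01 e10.
  move: (val X 0 0) (val X 0 1) (val X 1 0) (val X 1 1) => a b c d.
  move: (val Y 0 0) (val Y 0 1) (val Y 1 0) (val Y 1 1) => p q r s e00 e01 e10.
  by split; lia.
apply: val_inj; rewrite -[LHS]/(val X *m val Y) -[RHS]/(val Y *m val X).
apply: eq_mx2; rewrite !mulmx2E; move: c1 c2 c3;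
  move: (val X 0 0) (val X 0 1) (val X 1 0) (val X 1 1) => a b c d;
  move: (val Y 0 0) (val Y 0 1) (val Y 1 0) (val Y 1 1) => p q r s *; lia.
Qed.

Lemma SL2Z_disc X : (val X 0 0 - val X 1 1) ^+ 2 + 4 * val X 0 1 * val X 1 0 =
  \tr (val X) ^+ 2 - 4.
Proof.
rewrite /mxtrace sum_ord2; have := SL2Z_det X.
move: (val X 0 0) (val X 0 1) (val X 1 0) (val X 1 1) => a b c d D; lia.
Qed.

(** Up to a unit factor, X Y - Y X is [~ X, Y] - 1, whose determinant is
2 - tr [~ X, Y]. *)
Lemma SL2Z_tr_commg X Y : \tr (val [~ X, Y]%g) = 2 + SL2Z_cross X Y.
Proof.
have [x00 x01 x10 x11] := SL2Z_invE X; have [y00 y01 y10 y11] := SL2Z_invE Y.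
have -> : val [~ X, Y]%g =
    val X^-1%g *m (val Y^-1%g *m (val X *m val Y)) by [].
rewrite /mxtrace sum_ord2 !mulmx2E x00 x01 x10 x11 y00 y01 y10 y11.
rewrite /SL2Z_cross /cross_form /cross1 /cross2 /cross3.
have := SL2Z_det X; have := SL2Z_det Y.
move: (val X 0 0) (val X 0 1) (val X 1 0) (val X 1 1) => a b c d.
move: (val Y 0 0) (val Y 0 1) (val Y 1 0) (val Y 1 1) => p q r s DY DX.
have two : 2 = 2 * ((a * d - b * c) * (p * s - q * r)) by rewrite DX DY.
by rewrite [X in _ = X + _]two; ring.
Qed.

Lemma hyperbolic_offdiag X : hyperbolic X -> val X 0 1 != 0.
Proof.
move=> hX; apply/eqP => b0; have := SL2Z_disc X; rewrite b0 mulr0 mul0r addr0.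
by move=> /eqP; apply/negP; exact: hyperbolic_disc_not_square.
Qed.

Lemma hyperbolic_commute X Y : hyperbolic X -> SL2Z_cross X Y = 0 ->
  commute X Y.
Proof.
move=> hX cr; apply/SL2Z_commuteP.
exact: cross_form_hyperbolic hX (SL2Z_disc X) cr.
Qed.

(** The trace of the commutator is at least 2 as soon as one of the matrices is
not hyperbolic, by [cross_form_ge0]. If it is 2 then [cross_form] vanishes, and
the equality cases of the semidefinite forms give the result. *)
Lemma nonhyperbolic_commute X Y : ~ hyperbolic X -> ~ hyperbolic Y ->
  ~ hyperbolic [~ X, Y]%g -> commute X Y.
Proof.
have disc_le Z : ~ hyperbolic Z ->
    (val Z 0 0 - val Z 1 1) ^+ 2 + 4 * val Z 0 1 * val Z 1 0 <= 0.
  by rewrite /hyperbolic SL2Z_disc => /negP; rewrite -leNgt; set t := \tr _; nia.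
move=> /disc_le dX /disc_le dY; rewrite /hyperbolic SL2Z_tr_commg.
have cr0 : 0 <= SL2Z_cross X Y by exact: cross_form_ge0.
move=> hXY; have cr : SL2Z_cross X Y = 0 by lia.
apply/SL2Z_commuteP; move: dX; rewrite le_eqVlt => /orP[/eqP dX|dX]; last first.
  exact: cross_form_elliptic.
move: dY; rewrite le_eqVlt => /orP[/eqP dY|dY]; first exact: cross_form_parabolic.
have [c1 c2 c3] := cross_form_elliptic dY (etrans (cross_form_sym _ _ _ _ _ _) cr).
rewrite /cross1 /cross2 /cross3 in c1 c2 c3 *; split; lia.
Qed.

(** The traceless part of a matrix that commutes with [X] is proportional to
that of [X]. *)
Lemma centralizer_commute X Y Z : hyperbolic X -> commute X Y -> commute X Z ->
  commute Y Z.
Proof.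
move=> hX /SL2Z_commuteP[y1 y2 y3] /SL2Z_commuteP[z1 z2 z3].
have b0 := hyperbolic_offdiag hX; apply/SL2Z_commuteP.
rewrite /cross1 /cross2 /cross3 in y1 y2 y3 z1 z2 z3 *.
set b := val X 0 1 in b0 *; have b20 : b * b != 0 by rewrite mulf_neq0.
move: (val X 1 0) (val X 0 0 - val X 1 1) (val Y 0 1) (val Y 1 0)
  (val Y 0 0 - val Y 1 1) (val Z 0 1) (val Z 1 0) (val Z 0 0 - val Z 1 1)
  y1 y2 y3 z1 z2 z3 => c al q r be q' r' be' y1 y2 y3 z1 z2 z3.
have eqr : b * r = c * q by rewrite -/b in y1; lia.
have eqb : b * be = al * q by rewrite -/b in y2; lia.
have eqr' : b * r' = c * q' by rewrite -/b in z1; lia.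
have eqb' : b * be' = al * q' by rewrite -/b in z2; lia.
split; apply: (mulfI b20); rewrite mulr0.
- by have -> : b * b * (q * r' - r * q') = b * q * (b * r') - b * r * (b * q')
    by [ring]; rewrite eqr eqr'; ring.
- by have -> : b * b * (be * q' - q * be') = b * be * (b * q') - b * q * (b * be')
    by [ring]; rewrite eqb eqb'; ring.
- by have -> : b * b * (r * be' - r' * be) = b * r * (b * be') - b * r' * (b * be)
    by [ring]; rewrite eqb eqb' eqr eqr'; ring.
Qed.

Lemma hyperbolic_conj_eq X Y : hyperbolic X -> commute X Y ->
  \tr (val Y) = \tr (val X) -> Y = X \/ Y = X^-1%g.
Proof.
move=> hX /SL2Z_commuteP[c1 c2 c3] trE.
have D0 : \tr (val X) ^+ 2 - 4 != 0.
  apply/eqP => t0; have /eqP := etrans (expr0n _ 2) (esym t0).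
  by apply/negP; exact: hyperbolic_disc_not_square.
have trE' : val Y 0 0 + val Y 1 1 = val X 0 0 + val X 1 1.
  by move: trE; rewrite /mxtrace !sum_ord2.
have DY := SL2Z_disc Y; rewrite trE -SL2Z_disc in DY; rewrite -SL2Z_disc in D0.
have [x00 x01 x10 x11] := SL2Z_invE X.
have [[e1 e2 e3]|[e1 e2 e3]] :=
    parallel_same_disc (hyperbolic_offdiag hX) D0 DY c1 c2; [left|right];
  apply: val_inj; apply: eq_mx2; rewrite ?x00 ?x01 ?x10 ?x11 //;
  move: e2 trE'; move: (val X 0 0) (val X 1 1) (val Y 0 0) (val Y 1 1); lia.
Qed.

Lemma tr_conjg X Y : \tr (val (X ^ Y)%g) = \tr (val X).
Proof.
have -> : val (X ^ Y)%g = val Y^-1%g *m (val X *m val Y) by [].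
rewrite mxtrace_mulC -mulmxA.
have -> : val Y *m val Y^-1%g = 1%:M by rewrite -[LHS]/(val (Y * Y^-1)%g) mulgV.
by rewrite mulmx1.
Qed.

End SL2ZGeometry.

(** If no two hyperbolic elements of [G] have nonzero [SL2Z_cross], then they
all commute. Hence a hyperbolic [h] is sent by conjugation to [h] or [h^-1],
commutators centralise [h], and the centraliser of [h] is abelian. If there is
no hyperbolic element at all, then [G] is abelian. *)
Lemma nonsolvable_hyperbolic_pair (G : groupClosed SL2Z) :
  ~ solvable_group (subgroup_type G) ->
  exists X Y : subgroup_type G, [/\ hyperbolic (val X), hyperbolic (val Y) &
    SL2Z_cross (val X) (val Y) != 0].
Proof.
move=> nsol; apply: contrapT => npair.
have pair (X Y : subgroup_type G) : hyperbolic (val X) -> hyperbolic (val Y) ->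
    commute (val X) (val Y).
  move=> hX hY; apply: hyperbolic_commute => //; apply/eqP/negPn/negP => cr.
  by apply: npair; exists X, Y.
have commute_val (X Y : subgroup_type G) : commute (val X) (val Y) <-> commute X Y.
  split=> [XY|XY]; first exact: val_inj.
  by rewrite /commute -[LHS]/(val (X * Y)%g) XY.
have [[h hyp]|nohyp] := pselect (exists h : subgroup_type G, hyperbolic (val h)).
  apply: nsol; apply: (@metabelian_solvable _ [set x | commute h x]).
  - split=> [|x y hx hy]; first exact: commute1.
    by apply: commuteM => //; exact: commuteV.
  - have conj_h x : (h ^ x)%g = h \/ (h ^ x)%g = h^-1%g.
      have trE : \tr (val (val (h ^ x)%g)) = \tr (val (val h)).
        exact: (tr_conjg (val h) (val x)).
      have hyp' : hyperbolic (val (h ^ x)%g) by rewrite /hyperbolic trE.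
      have [E|E] := hyperbolic_conj_eq hyp (pair _ _ hyp hyp') trE.
        by left; exact: val_inj.
      by right; exact: val_inj.
    have conjV_h x : (h ^ x^-1)%g = (h ^ x)%g.
      apply: (can_inj (conjgK x)); rewrite conjgKV.
      have [E|E] := conj_h x; first by rewrite !E.
      by rewrite E conjVg E invgK.
    move=> x y /=.
    have comm : (h ^ (y * x) = h ^ (x * y))%g.
      rewrite !conjgM.
      by have [xE|xE] := conj_h x; have [yE|yE] := conj_h y;
        rewrite xE yE ?conjVg ?xE ?yE.
    have commE : ([~ x, y] = (y * x)^-1 * (x * y))%g.
      by rewrite commgEl /conjg invgM !mulgA.
    have fix_h : (h ^ [~ x, y] = h)%g.
      by rewrite commE conjgM conjV_h comm -(conjV_h (x * y)%g) conjgKV.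
    by rewrite /commute [LHS]conjgC fix_h.
  - move=> x y /commute_val hx /commute_val hy; apply/commute_val.
    exact: centralizer_commute hyp hx hy.
apply: nsol; apply: (@metabelian_solvable _ [set: _]) => // x y _ _.
apply/commute_val/nonhyperbolic_commute => hz; apply: nohyp.
- by exists x.
- by exists y.
- by exists [~ x, y]%g.
Qed.

(** * Actions of Z^2 on the line with a global fixed point *)

Lemma cV2_decomp (a : 'cV[int]_2) :
  a = delta_mx 0 0 *~ a 0 0 + delta_mx 1 0 *~ a 1 0.
Proof.
apply/matrixP => i j; rewrite ord1 !mxE -!scaler_int !mxE.
by case: (ord2P i) => ->; rewrite /= !intz; lia.
Qed.

Lemma fixed_by_generators (T : Type) (N : 'cV[int]_2 -> T -> T) y :
  (forall x, N 0 x = x) -> (forall a b x, N (a + b) x = N a (N b x)) ->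
  N (delta_mx 0 0) y = y -> N (delta_mx 1 0) y = y -> forall a, N a y = y.
Proof.
move=> N0 ND fix_e1 fix_e2 a.
have fix_n u n : N u y = y -> N (u *+ n) y = y.
  by move=> Nu; elim: n => [|n IH]; rewrite ?mulr0n ?N0// mulrS ND IH Nu.
have fix_z e (i : int) : N e y = y -> N (e *~ i) y = y.
  move=> Ne; case: (intP i) => [|n|n]; first by rewrite mulr0z N0.
    by rewrite -pmulrn fix_n.
  rewrite mulrNz -pmulrn -mulNrn fix_n// -{1}Ne -ND addNr N0//.
by rewrite (cV2_decomp a) ND !fix_z.
Qed.

Section PlaneAction.
Variables (R : realType) (N : 'cV[int]_2 -> R -> R).

Definition plane_action :=
  [/\ forall a, circle_map (N a), forall x, N 0 x = x,
      forall a b x, N (a + b) x = N a (N b x) & exists p, forall a, N a p = p].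

Hypothesis actN : plane_action.

Definition global_fixed y := forall a, N a y = y.

Definition orbit y : set R := range (N^~ y).

Definition lo y := inf (orbit y).
Definition hi y := sup (orbit y).

Lemma act_le a : {mono N a : x y / x <= y}.
Proof. by case: actN => cN _ _ _; exact: circle_map_le. Qed.

Lemma act_lt a : {mono N a : x y / x < y}.
Proof. by case: actN => cN _ _ _; exact: circle_map_lt. Qed.

Lemma act_NK a : cancel (N a) (N (- a)).
Proof. by case: actN => _ N0 ND _ x; rewrite -ND addNr N0. Qed.

Lemma act_KN a : cancel (N (- a)) (N a).
Proof. by case: actN => _ N0 ND _ x; rewrite -ND subrr N0. Qed.

Lemma actC a b x : N a (N b x) = N b (N a x).
Proof. by case: actN => _ _ ND _; rewrite -!ND addrC. Qed.

Lemma orbit_bounded y : exists l r, (forall a, l <= N a y <= r).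
Proof.
case: actN => cN _ _ [p Np].
have /andP[] := floor_itv (y - p); set m := Num.floor _; rewrite intrD => m1 m2.
exists (p + m%:~R), (p + (m + 1)%:~R) => a.
have E (k : int) : p + k%:~R = N a (p + k%:~R) by rewrite circle_map_addz// Np.
by apply/andP; split; rewrite E act_le ?intrD; lra.
Qed.

Lemma orbit_self y : orbit y y.
Proof. by case: actN => _ N0 _ _; exists 0. Qed.

Lemma has_sup_orbit y : has_sup (orbit y).
Proof.
split; first by exists y; exact: orbit_self.
have [l [r lr]] := orbit_bounded y.
by exists r => _ [a _ <-]; have /andP[] := lr a.
Qed.

Lemma has_inf_orbit y : has_inf (orbit y).
Proof.
split; first by exists y; exact: orbit_self.
have [l [r lr]] := orbit_bounded y.
by exists l => _ [a _ <-]; have /andP[] := lr a.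
Qed.

Let act_homo a : {homo N a : x y / x <= y}.
Proof. by move=> x y; rewrite act_le. Qed.

Let orbit_stable y a z : orbit y z -> orbit y (N a z).
Proof. by case: actN => _ _ ND _ [b _ <-]; exists (a + b) => //; rewrite ND. Qed.

Lemma hi_fixed y : global_fixed (hi y).
Proof.
move=> a; apply: (sup_invariant (has_sup_orbit y) (@act_homo a)
  (@act_homo (- a)) (act_NK a) (act_KN a)); exact: orbit_stable.
Qed.

Lemma lo_fixed y : global_fixed (lo y).
Proof.
move=> a; apply: (inf_invariant (has_inf_orbit y) (@act_homo a)
  (@act_homo (- a)) (act_NK a) (act_KN a)); exact: orbit_stable.
Qed.

Lemma act_le_hi a y : N a y <= hi y.
Proof. by apply: sup_upper_bound; [exact: has_sup_orbit | exists a]. Qed.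

Lemma lo_le_act a y : lo y <= N a y.
Proof. by apply: ge_inf; [exact: (has_inf_orbit y).2 | exists a]. Qed.

Lemma lo_lt_hi y : ~ global_fixed y -> lo y < y < hi y.
Proof.
case: (actN) => _ N0 _ _ nfix; rewrite !lt_neqAle.
have := lo_le_act 0 y; have := act_le_hi 0 y; rewrite N0 => -> ->.
rewrite !andbT; apply/andP; split; apply/eqP => E; apply: nfix.
  by rewrite -E; exact: lo_fixed.
by rewrite E; exact: hi_fixed.
Qed.

Lemma hull_cofinal y z : lo y < z < hi y ->
  (exists a, z < N a y) /\ (exists a, N a y < z).
Proof.
move=> /andP[lz zh]; split.
  have [||_ [a _ <-] za] := @sup_adherent R (orbit y) (hi y - z).
  - by rewrite subr_gt0.
  - exact: has_sup_orbit.
  - by exists a; rewrite subKr in za.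
have [||_ [a _ <-] za] := @inf_adherent R (orbit y) (z - lo y).
- by rewrite subr_gt0.
- exact: has_inf_orbit.
- by exists a; rewrite addrC subrK in za.
Qed.

Lemma hull_no_fixed y z : lo y < z < hi y -> ~ global_fixed z.
Proof.
move=> zI zfix; have [[a az] [b bz]] := hull_cofinal zI.
rewrite -(zfix a) act_lt in az; rewrite -(zfix b) act_lt in bz.
by have := lt_trans az bz; rewrite ltxx.
Qed.

(** These conditions characterise, up to a positive factor, the translation
number of the action on the interval ]lo y, hi y[ spanned by an orbit. *)
Definition slope y (tau : 'cV[int]_2 -> R) :=
  [/\ {morph tau : a b / a + b}, (exists c, tau c = 1) &
      forall a b, N a y <= N b y -> tau a <= tau b].

(** The orbit map of [y] pulls the order of the line back to a total preorder
on Z^2. The largest of the four vectors +- e1, +- e2 is a strong unit for it, and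
is positive because [y] is not fixed by both e1 and e2. *)
Lemma slope_exists y : ~ global_fixed y -> exists tau, slope y tau.
Proof.
case: (actN) => _ N0 ND _ nfix; pose le a b := N a y <= N b y.
have tot a b : le a b \/ le b a.
  by apply/orP; rewrite /le le_total.
have tr b a c : le a b -> le b c -> le a c by exact: le_trans.
have ad c a b : le a b -> le (a + c) (b + c).
  by rewrite /le !ND !(actC _ c) act_le.
have adD a b c d : le a b -> le c d -> le (a + c) (b + d).
  move=> /(ad c) ab /(ad b); rewrite ![_ + b]addrC; exact: tr.
have refl a : le a a by exact: lexx.
have max2 a b : exists c, le a c /\ le b c.
  by case: (tot a b) => ab; [exists b | exists a].
pose e1 : 'cV[int]_2 := delta_mx 0 0; pose e2 : 'cV[int]_2 := delta_mx 1 0.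
have [s [s1 s2]] := max2 e1 (- e1); have [t [t1 t2]] := max2 e2 (- e2).
have [c0 [sc tc]] := max2 s t.
have mulz (e c : 'cV[int]_2) (i : int) : le e c -> le (- e) c ->
    le (e *~ i) (c *+ `|i|%N).
  move=> ec nec; have Mn (u v : 'cV[int]_2) n : le u v -> le (u *+ n) (v *+ n).
    move=> uv; elim: n => [|n IH]; first exact: refl.
    by rewrite !mulrS; exact: adD.
  case: (intP i) => [|n|n]; first exact: refl.
    by rewrite -pmulrn; exact: Mn.
  by rewrite mulrNz -pmulrn abszN -mulNrn; exact: Mn.
have [] := @hoelder_embedding R _ le c0 tot tr ad.
- move=> c0n; have nonpos e : le e c0 -> le (- e) c0 -> N e y = y.
    move=> ec nec; apply/eqP; rewrite eq_le; apply/andP; split.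
      by have := tr _ _ _ ec c0n; rewrite /le N0.
    have := tr _ _ _ nec c0n => /(ad e).
    by rewrite /le addNr add0r N0.
  have fix_e1 : N e1 y = y by apply: nonpos; apply: tr sc.
  have fix_e2 : N e2 y = y by apply: nonpos; apply: tr tc.
  by apply: nfix => a; exact: fixed_by_generators.
- move=> v; exists (`|v 0%R 0%R| + `|v 1%R 0%R|)%N.
  rewrite {1}(cV2_decomp v) mulrnDr; apply: adD; apply: mulz.
  + exact: tr s1 sc.
  + exact: tr s2 sc.
  + exact: tr t1 tc.
  + exact: tr t2 tc.
move=> tau [tau1 tauD taule]; exists tau; split=> //.
by exists c0.
Qed.

Lemma slope0 y tau : slope y tau -> tau 0 = 0.
Proof.
by case=> tD _ _; apply: (addrI (tau 0)); rewrite -tD !addr0.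
Qed.

Lemma slopeN y tau a : slope y tau -> tau (- a) = - tau a.
Proof.
move=> st; have [tD _ _] := st; apply: (addrI (tau a)).
by rewrite -tD !subrr (slope0 st).
Qed.

Lemma slope_mulrn y tau a n : slope y tau -> tau (a *+ n) = tau a *+ n.
Proof.
move=> st; have [tD _ _] := st; elim: n => [|n IH]; first by rewrite (slope0 st).
by rewrite !mulrS tD IH.
Qed.

Lemma slope_mulrz y tau a (i : int) : slope y tau -> tau (a *~ i) = tau a *~ i.
Proof.
move=> st; case: (intP i) => [|n|n]; first by rewrite (slope0 st).
  by rewrite -!pmulrn (slope_mulrn _ _ st).
by rewrite !mulrNz -!pmulrn (slopeN _ st) (slope_mulrn _ _ st).
Qed.

(** If N c z <= z, then no iterate of N c moves a point N b y < z of the orbit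
beyond a point N a y > z, so that n tau(c) <= tau(a - b) for all n. *)
Lemma slope_pos y tau c z : slope y tau -> 0 < tau c -> lo y < z < hi y ->
  z < N c z.
Proof.
move=> st c0 zI; rewrite ltNge; apply/negP => Ncz.
have [tD _ tle] := st; have [_ N0 ND _] := actN.
have tlt a b : tau a < tau b -> N a y < N b y.
  by move=> ab; rewrite ltNge; apply: contraL ab => /tle; rewrite -leNgt.
have Nn n : N (c *+ n) z <= z.
  elim: n => [|n IH]; first by rewrite mulr0n N0.
  by rewrite mulrS ND; apply: le_trans Ncz; rewrite act_le.
have [[a az] [b bz]] := hull_cofinal zI.
have [n nab] : exists n : nat, tau (a - b) < tau c *+ n.
  exists (Num.truncn (tau (a - b) / tau c)).+1.
  by rewrite -mulr_natl -ltr_pdivrMr// truncnS_gt.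
have : N (a - b) y < N (c *+ n) y.
  by apply: tlt; rewrite (slope_mulrn _ _ st).
apply/negP; rewrite -leNgt -(act_le b) -!ND.
have -> : b + (a - b) = a by rewrite addrC subrK.
rewrite addrC ND; apply: le_trans (ltW az).
by apply: le_trans (Nn n); rewrite act_le ltW.
Qed.

End PlaneAction.

(** * Wandering components *)

Section Counting.
Variable R : realType.

(** Points at mutual distance at least [l] lie in distinct cells of a
subdivision of step [l]. *)
Lemma separated_card (I : finType) (p : I -> R) (c L l : R) : 0 <= L -> 0 < l ->
  (forall i, c <= p i <= c + L) -> (forall i j, i != j -> l <= `|p i - p j|) ->
  #|I|%:R <= L / l + 1.
Proof.
move=> L0 l0 pI sep; pose q i := (p i - c) / l.
have q0 i : 0 <= q i by rewrite divr_ge0 ?(ltW l0)// subr_ge0; case/andP: (pI i).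
have qL i : q i <= L / l.
  by rewrite ler_pM2r ?invr_gt0// lerBlDl; case/andP: (pI i).
pose f i : 'I_(Num.truncn (L / l)).+1 := inord (Num.truncn (q i)).
have fE i : f i = Num.truncn (q i) :> nat.
  by rewrite inordK// ltnS le_truncn.
have finj : injective f.
  move=> i j fij; apply/eqP/negPn/negP => /sep; apply/negP; rewrite -ltNge.
  have Eij : Num.truncn (q i) = Num.truncn (q j) by rewrite -!fE fij.
  have := truncn_itv (q0 i); have := truncn_itv (q0 j); rewrite Eij.
  set n := Num.truncn _; rewrite -natr1 => /andP[j1 j2] /andP[i1 i2].
  have -> : p i - p j = (q i - q j) * l by rewrite /q -mulrBl mulfVK ?gt_eqF//; ring.
  rewrite normrM [`|l|]gtr0_norm// -[X in _ < X]mul1r ltr_pM2r//.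
  by rewrite ltr_norml; apply/andP; split; lra.
have := leq_card f finj; rewrite card_ord -(ler_nat R) => /le_trans; apply.
by rewrite -natr1 lerD2r truncn_le divr_ge0// ltW.
Qed.

Lemma recurrence_growth (x : nat -> R) (t : int) : 2 < `|t| ->
  (forall i, x i.+2 = t%:~R * x i.+1 - x i) -> 2 * `|x 0%N| <= `|x 1%N| ->
  forall i, 2 * `|x i| <= `|x i.+1|.
Proof.
move=> t3 xE x01; elim=> // i IH; rewrite xE.
have t3' : 3 <= `|t%:~R : R| by rewrite -intr_norm (ler_int R 3); lia.
have := ler_distD (x i) (t%:~R * x i.+1) 0; rewrite !subr0 normrM => h.
have : 3 * `|x i.+1| <= `|t%:~R : R| * `|x i.+1| by rewrite ler_wpM2r.
have := normr_ge0 (x i); lra.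
Qed.

Lemma exp_unbounded (C A : R) : 0 < C ->
  exists n, A < (3 / 2) ^+ n * C.
Proof.
move=> C0; exists (Num.truncn (2 * A / C)).+1.
have := truncnS_gt (2 * A / C); set n := (Num.truncn _).+1; rewrite ltr_pdivrMr// => An.
have pn : 1 + n%:R / 2 <= (3 / 2) ^+ n :> R.
  elim: (n) => [|k IH]; first by rewrite expr0 mul0r addr0.
  rewrite exprS -[k.+1%:R]natr1; move: IH (ler0n R k).
  by move: (_ ^+ k) (k%:R) => u m ? ?; lra.
have : (1 + n%:R / 2) * C <= (3 / 2) ^+ n * C by rewrite ler_wpM2r// ltW.
by set u := _ * C in An *; rewrite mulrDl mul1r mulrAC -/u; lra.
Qed.

End Counting.

Section Wandering.
Variables (R : realType) (N : 'cV[int]_2 -> R -> R).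
Hypothesis actN : plane_action N.

(** The map [H] conjugates the action to its composite with [h]; the inverse
map and the inverse matrix are kept explicit. *)
Definition normalizes (h h' : 'M[int]_2) (H H' : R -> R) :=
  [/\ circle_map H /\ circle_map H', cancel H H' /\ cancel H' H,
      h *m h' = 1%:M /\ h' *m h = 1%:M &
      forall a y, H (N a y) = N (h *m a) (H y)].

Lemma normalizes_sym h h' H H' : normalizes h h' H H' -> normalizes h' h H' H.
Proof.
move=> [[cH cH'] [HK H'K] [hh' h'h] HN]; split=> // a y.
by apply: (can_inj HK); rewrite HN !H'K mulmxA hh' mul1mx.
Qed.

Lemma normalizes_iter h h' H H' n : normalizes h h' H H' ->
  forall a y, iter n H (N a y) = N (h ^+ n *m a) (iter n H y).
Proof.
move=> [_ _ _ HN] a y; elim: n => [|n IH]; first by rewrite expr0 mul1mx.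
by rewrite !iterS IH HN exprS mulmxA.
Qed.

Variables (h h' : 'M[int]_2) (H H' : R -> R).
Hypothesis norm_h : normalizes h h' H H'.

Let cN a : circle_map (N a). Proof. by case: actN. Qed.
Let cH : circle_map H. Proof. by case: norm_h => -[]. Qed.
Let cH' : circle_map H'. Proof. by case: norm_h => -[]. Qed.
Let HK : cancel H H'. Proof. by case: norm_h => _ []. Qed.
Let H'K : cancel H' H. Proof. by case: norm_h => _ []. Qed.

Lemma normalizes_fixed y : global_fixed N y -> global_fixed N (H' y).
Proof.
move=> yfix a; have [_ _ _ H'N] := normalizes_sym norm_h.
have [_ _ [_ h'h] _] := norm_h.
by rewrite -[in LHS](mul1mx a) -h'h -mulmxA -H'N yfix.
Qed.

Lemma normalizes_fixedV y : global_fixed N (H' y) -> global_fixed N y.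
Proof.
move=> yfix a; have [_ _ _ H'N] := normalizes_sym norm_h.
by apply: (can_inj H'K); rewrite H'N yfix.
Qed.

Lemma global_fixed_addz y (m : int) : global_fixed N y ->
  global_fixed N (y + m%:~R).
Proof. by move=> yfix a; rewrite circle_map_addz// yfix. Qed.

(** ]l, r[ is a connected component of the complement of the set of global
fixed points. *)
Definition component l r :=
  [/\ l < r, global_fixed N l, global_fixed N r &
      forall z, l < z < r -> ~ global_fixed N z].

Lemma component_addz l r (m : int) : component l r ->
  component (l + m%:~R) (r + m%:~R).
Proof.
case=> lr lfix rfix nfix; split.
- by rewrite ltrD2r.
- exact: global_fixed_addz.
- exact: global_fixed_addz.
move=> z zI zfix; apply: (nfix (z + (- m)%:~R)); last exact: global_fixed_addz.
by move: zI => /andP[z1 z2]; rewrite mulrNz; apply/andP; split; lra.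
Qed.

Lemma component_preim l r : component l r -> component (H' l) (H' r).
Proof.
case=> lr lfix rfix nfix; split.
- by rewrite circle_map_lt.
- exact: normalizes_fixed.
- exact: normalizes_fixed.
move=> z zI zfix; apply: (nfix (H z)); last first.
  by apply: normalizes_fixedV; rewrite HK.
by rewrite -(circle_map_lt cH' l) -(circle_map_lt cH' (H z) r) HK.
Qed.

(** Components are equal or disjoint, and components longer than the distance
between their left end points are not disjoint. *)
Lemma component_close l r l2 r2 d : component l r -> component l2 r2 ->
  d <= r - l -> d <= r2 - l2 -> `|l - l2| < d -> l = l2 /\ r = r2.
Proof.
move=> [lr lfix rfix nfix] [lr2 lfix2 rfix2 nfix2] d1 d2.
rewrite ltr_norml => /andP[a1 a2].
have ll2 : l = l2.
  case: (ltgtP l l2) => // [ll|ll].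
    by case: (nfix l2) => //; apply/andP; split; lra.
  by case: (nfix2 l) => //; apply/andP; split; lra.
split=> //; rewrite -{}ll2 in lr2 nfix2.
case: (ltgtP r r2) => // [rr|rr].
  by case: (nfix2 r) => //; apply/andP.
by case: (nfix r2) => //; apply/andP.
Qed.

Variables (l0 r0 : R).
Hypothesis comp0 : component l0 r0.

Let l k := iter k H' l0.
Let r k := iter k H' r0.

Let comp k : component (l k) (r k).
Proof. by elim: k => //= k IH; exact: component_preim. Qed.

(** No two iterates of the component have the same image in the circle. *)
Definition wandering := forall n (m : int), (0 < n)%N ->
  ~ (iter n H' l0 = l0 + m%:~R /\ iter n H' r0 = r0 + m%:~R).

Hypothesis wand : wandering.

Let iterHK k : cancel (iter k H') (iter k H).
Proof. by move=> y; elim: k y => //= k IH y; rewrite -iterS iterSr H'K IH. Qed.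

Lemma wandering_separated j k d : (j < k)%N ->
  d <= r j - l j -> d <= r k - l k ->
  d <= `|(l j - (Num.floor (l j))%:~R) - (l k - (Num.floor (l k))%:~R)|.
Proof.
move=> jk dj dk; rewrite leNgt; apply/negP => close.
pose m : int := Num.floor (l k) - Num.floor (l j).
have [|||E1 E2] := component_close (component_addz m (comp j)) (comp k) (d := d).
- by apply: le_trans dj _; lra.
- exact: dk.
- move: close; congr (`| _ | < _); rewrite /m intrB; ring.
have kj : (0 < k - j)%N by rewrite subn_gt0.
case: (@wand _ m kj).
have iterE y : iter k H' y = iter j H' (iter (k - j) H' y).
  by rewrite -iterD subnKC// ltnW.
have inj : injective (iter j H') := can_inj (iterHK j).
by split; apply: inj; rewrite -iterE (circle_map_addz _ _ (circle_map_iter j cH')).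
Qed.

(** The images in the circle of the iterates are pairwise disjoint, so that
only finitely many of them are longer than [d]. *)
Lemma wandering_shrinks d : 0 < d ->
  exists K, forall k, (K <= k)%N -> r k - l k < d.
Proof.
move=> d0; apply: contrapT => noK.
have /choice[g gP] : forall K, exists k, (K <= k)%N /\ d <= r k - l k.
  move=> K; apply: contrapT => nok; apply: noK; exists K => k Kk.
  by rewrite ltNge; apply/negP => dk; apply: nok; exists k.
pose s := fix s i := if i is i'.+1 then g (s i').+1 else g 0%N.
have sP i : d <= r (s i) - l (s i) by case: i => [|i]; exact: (gP _).2.
have s_incr i j : (i < j)%N -> (s i < s j)%N.
  elim: j => // j IH; rewrite ltnS leq_eqVlt => /orP[/eqP ->|/IH sij].
    exact: (gP _).1.
  exact: ltn_trans sij (gP _).1.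
pose p (i : 'I_(Num.truncn (1 / d + 1)).+1) : R :=
  l (s i) - (Num.floor (l (s i)))%:~R.
have p01 i : 0 <= p i <= 0 + 1.
  have := floor_itv (l (s i)); rewrite /p intrD.
  by move=> /andP[f1 f2]; apply/andP; split; lra.
have p_sep i j : i != j -> d <= `|p i - p j|.
  rewrite -(inj_eq val_inj) neq_ltn => /orP[] /s_incr ij.
    exact: wandering_separated.
  by rewrite distrC; exact: wandering_separated.
have := separated_card ler01 d0 p01 p_sep.
by rewrite card_ord leNgt truncnS_gt.
Qed.

(** On a short interval whose end points are fixed, the derivative is
everywhere close to the value one it takes somewhere. *)
Lemma wandering_act_distortion a : exists K, forall k, (K <= k)%N ->
  forall u v, l k <= u -> u < v -> v <= r k ->
  7 / 8 * (v - u) <= N a v - N a u.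
Proof.
have e0 : 0 < 1 / 8 :> R by lra.
have [d d0 unif] := circle_map_derive1_unif_continuous (cN a) e0.
have [K KP] := wandering_shrinks d0; exists K => k Kk u v lu uv vr.
have rl := KP k Kk; have [lr lfix rfix _] := comp k.
have [[dN _] _ _] := cN a.
have [x /andP[x1 x2] ->] := derivable_MVT dN uv.
have [y /andP[y1 y2]] := derivable_MVT dN lr; rewrite rfix lfix => E.
have E1 : derive1 (N a) y = 1.
  by apply: (mulIf (_ : r k - l k != 0)); rewrite ?mul1r// subr_eq0 gt_eqF.
have : `|derive1 (N a) y - derive1 (N a) x| < 1 / 8.
  by apply: unif; rewrite ltr_norml; apply/andP; split; lra.
rewrite E1 ltr_norml => /andP[h1 h2].
by rewrite ler_wpM2r ?subr_ge0 ?(ltW uv)//; lra.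
Qed.

(** On a short interval the derivative of [H] is nearly constant, relatively to
its size, which is bounded below. *)
Lemma wandering_conj_distortion : exists K, forall k, (K <= k)%N ->
  forall u v u2 v2, l k <= u -> u < v -> v <= r k ->
  l k <= u2 -> u2 < v2 -> v2 <= r k ->
  7 / 8 * ((H v - H u) * (v2 - u2)) <= (H v2 - H u2) * (v - u).
Proof.
have [m m0 Hm] := circle_map_derive1_lower_bound cH.
have e0 : 0 < m / 8 by lra.
have [d d0 unif] := circle_map_derive1_unif_continuous cH e0.
have [K KP] := wandering_shrinks d0.
exists K => k Kk u v u2 v2 lu uv vr lu2 uv2 vr2.
have rl := KP k Kk.
have [[dH _] _ _] := cH.
have [x /andP[x1 x2] ->] := derivable_MVT dH uv.
have [y /andP[y1 y2] ->] := derivable_MVT dH uv2.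
have : `|derive1 H x - derive1 H y| < m / 8.
  by apply: unif; rewrite ltr_norml; apply/andP; split; lra.
rewrite ltr_norml => /andP[h1 h2]; have := Hm x; have := Hm y => my mx.
have -> : derive1 H y * (v2 - u2) * (v - u) = derive1 H y * ((v - u) * (v2 - u2)).
  by ring.
have -> : 7 / 8 * (derive1 H x * (v - u) * (v2 - u2)) =
    7 / 8 * derive1 H x * ((v - u) * (v2 - u2)) by ring.
by apply: ler_wpM2r; [rewrite mulr_ge0// subr_ge0 ltW | lra].
Qed.

Variable a0 : 'cV[int]_2.

(** Horner form of the sum of the h^i a0 over the indices i at which [es] is
true. *)
Fixpoint word (es : seq bool) : 'cV[int]_2 :=
  if es is e :: es' then a0 *+ e + h *m word es' else 0.

(** The element [h (word es)] acts on the k-th interval as the conjugate by [H]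
of the action of [word es] on the next one. The two factors 7/8 lost at each
letter come from this conjugation and from [a0], and (7/8)^2 >= 3/4. The point is
that 3/4 > 1/2, the inverse of the number of letters. *)
Lemma wandering_word_distortion : exists K, forall es k, (K <= k)%N ->
  forall u v, l k <= u -> u < v -> v <= r k ->
  (3 / 4) ^+ size es * (v - u) <= N (word es) v - N (word es) u.
Proof.
have [K1 actP] := wandering_act_distortion a0.
have [K2 conjP] := wandering_conj_distortion.
have [_ N0 ND _] := actN; have [_ _ _ HN] := norm_h.
exists (maxn K1 K2); elim=> [|e es IH] k Kk u v lu uv vr.
  by rewrite /= expr0 mul1r !N0.
have [K1k K2k] : (K1 <= k)%N /\ (K2 <= k.+1)%N by lia.
have Kk1 : (maxn K1 K2 <= k.+1)%N by lia.
have [_ lfix rfix _] := comp k; have [_ lfix1 rfix1 _] := comp k.+1.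
have uv' : H' u < H' v by rewrite circle_map_lt.
have lu' : l k.+1 <= H' u by rewrite /l /= circle_map_le.
have vr' : H' v <= r k.+1 by rewrite /r /= circle_map_le.
have := IH k.+1 Kk1 (H' u) (H' v) lu' uv' vr'.
set U := N (word es) (H' u); set V := N (word es) (H' v) => UV.
have UVlt : U < V by rewrite circle_map_lt.
have lU : l k.+1 <= U by rewrite -(lfix1 (word es)) circle_map_le.
have Vr : V <= r k.+1 by rewrite -(rfix1 (word es)) circle_map_le.
have conjE y : N (h *m word es) y = H (N (word es) (H' y)) by rewrite HN H'K.
rewrite /= !ND !conjE -/U -/V.
have := conjP k.+1 K2k _ _ _ _ lu' uv' vr' lU UVlt Vr; rewrite !H'K => cj.
have lHU : l k <= H U by rewrite -(circle_map_le cH') HK; exact: lU.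
have HVr : H V <= r k by rewrite -(circle_map_le cH') HK; exact: Vr.
have HUV : H U < H V by rewrite circle_map_lt.
have ac : 7 / 8 * (H V - H U) <= N (a0 *+ e) (H V) - N (a0 *+ e) (H U).
  case: e; first exact: (actP k K1k _ _ lHU HUV HVr).
  by rewrite mulr0n !N0; lra.
apply: le_trans ac; rewrite exprS -mulrA.
have d'0 : 0 < H' v - H' u by rewrite subr_gt0.
have d0 : 0 < v - u by rewrite subr_gt0.
rewrite -(ler_pM2r d'0).
have key : 7 / 8 * ((v - u) * ((3 / 4) ^+ size es * (H' v - H' u))) <=
    (H V - H U) * (H' v - H' u).
  apply: le_trans cj; rewrite ler_pM2l; last by lra.
  by rewrite ler_pM2l.
rewrite -[X in _ <= X]mulrA.
apply: (@le_trans _ _ (7 / 8 * (7 / 8 *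
    ((v - u) * ((3 / 4) ^+ size es * (H' v - H' u)))))); last first.
  by rewrite ler_pM2l//; lra.
set P := (3 / 4) ^+ size es.
have -> : 3 / 4 * (P * (v - u)) * (H' v - H' u) =
    3 / 4 * ((v - u) * (P * (H' v - H' u))) by ring.
rewrite mulrA ler_wpM2r//; last by lra.
by rewrite !mulr_ge0// ?exprn_ge0//; lra.
Qed.

End Wandering.

Section NoWandering.
Variables (R : realType) (N : 'cV[int]_2 -> R -> R).
Hypothesis actN : plane_action N.
Variables (h h' : 'M[int]_2) (H H' : R -> R) (t : int).
Hypothesis norm_h : normalizes N h h' H H'.
Hypothesis tr_h : h + h' = t%:M.
Hypothesis hyp_t : 2 < `|t|.

(** Cayley-Hamilton: h^2 = t h - 1. *)
Lemma matrix_recurrence n (a : 'cV[int]_2) :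
  h ^+ n.+2 *m a = (h ^+ n.+1 *m a) *~ t - h ^+ n *m a.
Proof.
have [_ _ [hh' _] _] := norm_h.
have hh : h *m h = h *~ t - 1%:M.
  have -> : h *m h = h *m (h + h') - h *m h' by rewrite mulmxDr addrK.
  by rewrite tr_h hh' mul_mx_scalar -[t in LHS]intz scaler_int.
have -> : h ^+ n.+2 = h ^+ n *m (h *m h) by rewrite mulmxA !exprSr.
rewrite hh mulmxBr mulmx1 mulmxBl; congr (_ - _).
by rewrite -!scaler_int -scalemxAr -scalemxAl exprSr.
Qed.

Lemma slope_recurrence y tau a : slope N y tau ->
  forall n, tau (h ^+ n.+2 *m a) =
    t%:~R * tau (h ^+ n.+1 *m a) - tau (h ^+ n *m a).
Proof.
move=> st n; have [tD _ _] := st.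
by rewrite matrix_recurrence tD (slopeN _ st) (slope_mulrz _ _ st) mulrzl.
Qed.

Let cH' : circle_map H'. Proof. by case: norm_h => -[]. Qed.
Let cH : circle_map H. Proof. by case: norm_h => -[]. Qed.

Let iterHK k : cancel (iter k H) (iter k H').
Proof.
have [_ [HK _] _ _] := norm_h.
by move=> y; elim: k y => //= k IH y; rewrite -iterS iterSr HK IH.
Qed.

Let iterH'K k : cancel (iter k H') (iter k H).
Proof.
have [_ [_ H'K] _ _] := norm_h.
by move=> y; elim: k y => //= k IH y; rewrite -iterS iterSr H'K IH.
Qed.

Variables (y : R) (tau : 'cV[int]_2 -> R).
Hypothesis nfix_y : ~ global_fixed N y.
Hypothesis slope_tau : slope N y tau.

Let l k := iter k H' (lo N y).
Let r k := iter k H' (hi N y).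

Lemma hull_component : component N (lo N y) (hi N y).
Proof.
have /andP[ly yh] := lo_lt_hi actN nfix_y; split.
- exact: lt_trans yh.
- exact: lo_fixed.
- exact: hi_fixed.
- by move=> z; exact: hull_no_fixed.
Qed.

Lemma slope_pos_iter k c w : 0 < tau (h ^+ k *m c) -> l k < w < r k ->
  w < N c w.
Proof.
move=> c0 wI; have cH'k := circle_map_iter k cH'.
rewrite -[w](iterHK k) -(circle_map_lt (circle_map_iter k cH)).
rewrite (normalizes_iter k norm_h) iterHK.
apply: (slope_pos actN slope_tau c0).
by rewrite -(circle_map_lt cH'k) -(circle_map_lt cH'k _ (hi N y)) iterHK.
Qed.

Variable a0 : 'cV[int]_2.
Let x k := tau (h ^+ k *m a0).
Hypothesis x0 : x 0%N != 0.
Hypothesis x01 : 2 * `|x 0%N| <= `|x 1%N|.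

Let x_growth k : 2 * `|x k| <= `|x k.+1|.
Proof.
exact: (@recurrence_growth R x t hyp_t (slope_recurrence a0 slope_tau) x01 k).
Qed.

Let x_neq0 k : 0 < `|x k|.
Proof.
elim: k => [|k IH]; first by rewrite normr_gt0.
by have := x_growth k; lra.
Qed.

(** Each slope is at least twice the previous one, so that the last letter at
which two words differ decides. *)
Lemma word_separated k es es' : size es = size es' -> es != es' ->
  `|x k| <= `|tau (h ^+ k *m word h a0 es) - tau (h ^+ k *m word h a0 es')|.
Proof.
have [tD _ _] := slope_tau.
have wordE j e es1 : tau (h ^+ j *m word h a0 (e :: es1)) =
    x j *+ e + tau (h ^+ j.+1 *m word h a0 es1).
  rewrite /= mulmxDr tD exprSr mulmxA; congr (_ + _).
  by case: e => //; rewrite mulr0n mulmx0 (slope0 slope_tau).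
elim: es es' k => [|e es IH] [|e' es'] k //= [sz].
rewrite eqseq_cons -/(word h a0 (e :: es)) -/(word h a0 (e' :: es')) !wordE.
case: (eqVneq es es') => [<-|nes] /=.
  rewrite andbT => ee; rewrite opprD addrACA subrr addr0.
  by case: e e' ee => [] [] //= _; rewrite ?mulr1n ?mulr0n ?subr0 ?sub0r ?normrN.
move=> _; have := IH _ k.+1 sz nes; have := x_growth k; have := x_neq0 k.
set A := tau _; set B := tau _; move=> xk g AB.
have d1 : `|x k *+ e - x k *+ e'| <= `|x k|.
  by case: e e' => [] [];
    rewrite ?mulr1n ?mulr0n ?subr0 ?sub0r ?subrr ?normr0 ?normrN ?normr_ge0.
have := ler_normB (x k *+ e + A - (x k *+ e' + B)) (x k *+ e - x k *+ e').
have -> : x k *+ e + A - (x k *+ e' + B) - (x k *+ e - x k *+ e') = A - B by ring.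
by move=> h2; apply: le_trans (_ : `|x k.+1| - `|x k| <= _); lra.
Qed.

(** In a wandering component, the words of length n move a fundamental interval
]xK, N u xK[ to 2 ^ n disjoint intervals, by [word_separated] and [slope_pos_iter].
By [wandering_word_distortion] their lengths are at least of the order of
(3/4) ^ n, while their total length is bounded. *)
Lemma hyperbolic_not_wandering : ~ wandering H' (lo N y) (hi N y).
Proof.
move=> wand; have [tD _ _] := slope_tau; have [cN N0 ND _] := actN.
have [K distortion] :=
  wandering_word_distortion actN norm_h hull_component wand a0.
have cH'K := circle_map_iter K cH'.
pose xK := iter K H' y.
have /andP[lx xr] : l K < xK < r K.
  by rewrite !circle_map_lt//; exact: lo_lt_hi.
have [u [u0 uE]] : exists u, 0 < tau (h ^+ K *m u) /\ tau (h ^+ K *m u) = `|x K|.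
  case: (ltgtP 0 (x K)) => xk.
  - by exists a0; rewrite gtr0_norm.
  - by exists (- a0); rewrite mulmxN (slopeN _ slope_tau) ltr0_norm// oppr_gt0.
  - by have := x_neq0 K; rewrite -xk normr0 ltxx.
have uI : xK < N u xK by apply: slope_pos_iter u0 _; rewrite lx xr.
have fix_lr : global_fixed N (l K) /\ global_fixed N (r K).
  have : component N (l K) (r K).
    elim: K {distortion cH'K xK lx xr u0 uE uI} => [|k IH].
      exact: hull_component.
    exact: (component_preim norm_h IH).
  by case.
have actI a w : l K < w < r K -> l K < N a w < r K.
  by rewrite -{2}(fix_lr.1 a) -{2}(fix_lr.2 a) !act_lt.
pose g := N u xK - xK.
have g0 : 0 < g by rewrite subr_gt0.
have [n An] := @exp_unbounded R (3 / 4 * g) (r K - l K + g) (ltac:(lra)).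
(* the leading [false] makes slopes differ by |x K.+1| > |x K|, strictly more
than the slope of [u] *)
pose P (es : n.-tuple bool) := N (word h a0 (false :: es)) xK.
pose d := (3 / 4) ^+ n.+1 * g.
have d0 : 0 < d by rewrite mulr_gt0// exprn_gt0//; lra.
have gap (es es' : n.-tuple bool) :
    `|x K| < tau (h ^+ K *m word h a0 (false :: es')) -
             tau (h ^+ K *m word h a0 (false :: es)) -> d <= P es' - P es.
  move=> sep; set w := word h a0 (false :: es); set w' := word h a0 (false :: es').
  apply: (@le_trans _ _ (N w (N u xK) - N w xK)).
    have := distortion (false :: es) K (leqnn K) xK (N u xK) (ltW lx) uI _.
    rewrite /= size_tuple; apply.
    by have /andP[_ /ltW] := actI u xK (ltac:(by rewrite lx xr)).
  rewrite lerD2r ltW// /P -/w'.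
  have -> : w' = (w' - w - u) + (w + u) by rewrite -[w' - w - u]addrA -opprD subrK.
  rewrite -ND [X in _ < X]ND; apply: slope_pos_iter; last by apply: actI; rewrite lx xr.
  by rewrite !mulmxBr !tD !(slopeN _ slope_tau) uE subr_gt0.
have P_sep es es' : es != es' -> d <= `|P es - P es'|.
  move=> ne.
  have := @word_separated K.+1 es es'; rewrite !size_tuple => /(_ erefl ne).
  have wE (es1 : seq bool) : h ^+ K.+1 *m word h a0 es1 =
      h ^+ K *m word h a0 (false :: es1).
    by rewrite /= mulr0n add0r exprSr mulmxA.
  rewrite !wE; have := x_growth K; have := x_neq0 K => p1 p2 p3.
  have : `|x K| < `|tau (h ^+ K *m word h a0 (false :: es)) -
                   tau (h ^+ K *m word h a0 (false :: es'))|.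
    by apply: lt_le_trans p3; lra.
  rewrite ltr_normr opprB => /orP[] /gap hd.
    by apply: le_trans hd (ler_norm _).
  by rewrite distrC; apply: le_trans hd (ler_norm _).
have P_bd es : l K <= P es <= l K + (r K - l K).
  have /andP[p1 p2] := actI (word h a0 (false :: es)) xK (ltac:(by rewrite lx xr)).
  by rewrite /P; apply/andP; split; lra.
have L0 : 0 <= r K - l K by lra.
have := separated_card L0 d0 P_bd P_sep.
rewrite card_tuple card_bool -lerBlDr ler_pdivlMr// leNgt => /negP; apply.
have dg : d <= g.
  by rewrite /d ler_piMl// ?(ltW g0)// exprn_ile1//; lra.
have dE : (2 ^ n)%:R * d = (3 / 2) ^+ n * (3 / 4 * g).
  have -> : 3 / 2 = 2 * (3 / 4) :> R by field.
  by rewrite exprMn natrX /d exprSr; ring.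
by rewrite mulrBl mul1r dE; lra.
Qed.

End NoWandering.

(** * Slopes are eigenvectors *)

Lemma mulmxMz (M : 'M[int]_2) (a : 'cV[int]_2) (i : int) :
  M *m (a *~ i) = (M *m a) *~ i.
Proof. exact: (raddfMz (mulmx M)). Qed.

Section Eigenvector.
Variable R : realType.

(** Two linear forms that are not proportional take prescribed signs, at real
points, hence at integral points of large size. *)
Lemma half_planes_parallel (u v u' v' : R) :
  (forall i j : int, 0 < u * i%:~R + v * j%:~R ->
    0 <= u' * i%:~R + v' * j%:~R) -> u * v' - v * u' = 0.
Proof.
move=> pos; apply/eqP/negPn/negP => D0; set D := _ - _ in D0.
pose a := (v' + v) / D; pose b := - (u + u') / D.
have ab1 : u * a + v * b = 1.
  by rewrite /a /b; have : D / D = 1 by [rewrite divff]; rewrite {1}/D => E; lra.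
have ab2 : u' * a + v' * b = - 1.
  by rewrite /a /b; have : D / D = 1 by [rewrite divff]; rewrite {1}/D => E; lra.
pose M := (Num.truncn (`|u| + `|v| + `|u'| + `|v'|)).+1.
have MM : `|u| + `|v| + `|u'| + `|v'| < M%:R := truncnS_gt _.
pose i := Num.floor (M%:R * a); pose j := Num.floor (M%:R * b).
have small (c x : R) : 0 <= x -> x < 1 -> - `|c| <= c * x <= `|c|.
  move=> x0 x1; rewrite -ler_norml normrM (ger0_norm x0) ler_piMr//; exact: ltW.
have /andP[i1 i2] := floor_itv (M%:R * a).
have /andP[j1 j2] := floor_itv (M%:R * b).
rewrite -/i intrD in i1 i2; rewrite -/j intrD in j1 j2.
set x := i%:~R in i1 i2 *; set y := j%:~R in j1 j2 *.
have dx0 : 0 <= M%:R * a - x by lra.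
have dx1 : M%:R * a - x < 1 by lra.
have dy0 : 0 <= M%:R * b - y by lra.
have dy1 : M%:R * b - y < 1 by lra.
have /andP[_ s1] := small u _ dx0 dx1; have /andP[_ s2] := small v _ dy0 dy1.
have /andP[s3 _] := small u' _ dx0 dx1; have /andP[s4 _] := small v' _ dy0 dy1.
have E1 : u * x + v * y =
    M%:R * (u * a + v * b) - u * (M%:R * a - x) - v * (M%:R * b - y) by ring.
have E2 : u' * x + v' * y =
    M%:R * (u' * a + v' * b) - u' * (M%:R * a - x) - v' * (M%:R * b - y) by ring.
rewrite ab1 mulr1 in E1; rewrite ab2 mulrN1 in E2.
have := normr_ge0 u; have := normr_ge0 v; have := normr_ge0 u'.
have := normr_ge0 v' => n1 n2 n3 n4.
have := pos i j; rewrite -/x -/y E1 E2 => /(_ ltac:(lra)); lra.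
Qed.

Variables (N : 'cV[int]_2 -> R -> R).
Hypothesis actN : plane_action N.
Variables (y : R) (tau : 'cV[int]_2 -> R).
Hypothesis nfix_y : ~ global_fixed N y.
Hypothesis slope_tau : slope N y tau.

Local Notation e1 := (delta_mx 0 0 : 'cV[int]_2).
Local Notation e2 := (delta_mx 1 0 : 'cV[int]_2).

Lemma slope_coords (M : 'M[int]_2) a :
  tau (M *m a) = tau (M *m e1) * (a 0 0)%:~R + tau (M *m e2) * (a 1 0)%:~R.
Proof.
have [tD _ _] := slope_tau.
rewrite [in LHS](cV2_decomp a) mulmxDr tD !mulmxMz.
by rewrite !(slope_mulrz _ _ slope_tau) !mulrzr.
Qed.

Lemma not_wandering_recurrent H' : ~ wandering H' (lo N y) (hi N y) ->
  exists (n : nat) (m : int), [/\ (0 < n)%N,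
    iter n H' (lo N y) = lo N y + m%:~R & iter n H' (hi N y) = hi N y + m%:~R].
Proof.
move=> nwand; apply: contrapT => nrec; apply: nwand => n m n0 [E1 E2].
by apply: nrec; exists n, m.
Qed.

Variables (h h' : 'M[int]_2) (H H' : R -> R) (t : int).
Hypothesis norm_h : normalizes N h h' H H'.
Hypothesis tr_h : h + h' = t%:M.
Hypothesis hyp_t : 2 < `|t|.

Let cH : circle_map H. Proof. by case: norm_h => -[]. Qed.
Let cH' : circle_map H'. Proof. by case: norm_h => -[]. Qed.

(** The slopes of the images of some vector grow along the positive or along
the negative powers of a hyperbolic matrix. *)
Lemma hyperbolic_recurrent : exists (n : nat) (m : int), [/\ (0 < n)%N,
    iter n H' (lo N y) = lo N y + m%:~R & iter n H' (hi N y) = hi N y + m%:~R].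
Proof.
have [_ [a a1] _] := slope_tau.
have a0 : tau a != 0 by rewrite a1 oner_neq0.
have rec b n := slope_recurrence norm_h tr_h b slope_tau n.
have t3 : 3 <= `|t%:~R : R| by rewrite -intr_norm (ler_int R 3); lia.
have [ha|ha] := leP `|tau a| `|tau (h *m a)|.
  apply: not_wandering_recurrent.
  apply: (hyperbolic_not_wandering actN norm_h tr_h hyp_t nfix_y slope_tau (a0 := h *m a)).
    rewrite expr0 mul1mx -normr_gt0; apply: lt_le_trans ha.
    by rewrite normr_gt0.
  rewrite expr0 mul1mx expr1.
  have := rec a 0%N; rewrite expr0 mul1mx expr1 expr2 -mulmxA => ->.
  have := ler_normB (t%:~R * tau (h *m a) - tau a) (- tau a).
  rewrite opprK subrK normrN normrM => n1.
  have : 3 * `|tau (h *m a)| <= `|t%:~R : R| * `|tau (h *m a)| by rewrite ler_wpM2r.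
  lra.
have tr_h' : h' + h = t%:M by rewrite addrC.
have [n [m [n0 E1 E2]]] : exists (n : nat) (m : int), [/\ (0 < n)%N,
    iter n H (lo N y) = lo N y + m%:~R & iter n H (hi N y) = hi N y + m%:~R].
  apply: not_wandering_recurrent.
  apply: (hyperbolic_not_wandering actN (normalizes_sym norm_h) tr_h' hyp_t nfix_y slope_tau (a0 := a)).
    by rewrite expr0 mul1mx.
  rewrite expr0 mul1mx expr1.
  have E : tau (h' *m a) = t%:~R * tau a - tau (h *m a).
    have [tD _ _] := slope_tau.
    have -> : h' *m a = t *: a - h *m a.
      by rewrite -mul_scalar_mx -tr_h mulmxDl addrC addKr.
    by rewrite tD (slopeN _ slope_tau) -[t in LHS]intz scaler_int (slope_mulrz _ _ slope_tau) mulrzl.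
  have := ler_normB (tau (h' *m a)) (- tau (h *m a)).
  rewrite opprK {1}E subrK normrN normrM => n1.
  have : 3 * `|tau a| <= `|t%:~R : R| * `|tau a| by rewrite ler_wpM2r.
  lra.
have iterHK : cancel (iter n H) (iter n H').
  have [_ [HK _] _ _] := norm_h => z.
  by elim: (n) z => //= k IH z; rewrite -iterS iterSr HK IH.
exists n, (- m); split=> //.
  rewrite -[in RHS](iterHK (lo N y)) E1.
  by rewrite -circle_map_addz ?mulrNz ?addrK//; exact: circle_map_iter.
rewrite -[in RHS](iterHK (hi N y)) E2.
by rewrite -circle_map_addz ?mulrNz ?addrK//; exact: circle_map_iter.
Qed.

(** A translate of the n-th iterate of [H'] preserves the component, on which
the sign of the slope of [a] decides in which direction [a] moves the points. *)
Lemma recurrent_slope_pos n (m : int) : iter n H' (lo N y) = lo N y + m%:~R ->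
  iter n H' (hi N y) = hi N y + m%:~R ->
  forall a, 0 < tau a -> 0 <= tau (h ^+ n *m a).
Proof.
move=> E1 E2 a a0; have [_ _ tle] := slope_tau; have [cN N0 _ _] := actN.
have cHn := circle_map_iter n cH; have cH'n := circle_map_iter n cH'.
have iterH'K : cancel (iter n H') (iter n H).
  have [_ [_ H'K] _ _] := norm_h => z.
  by elim: (n) z => //= k IH z; rewrite -iterS iterSr H'K IH.
pose w := iter n H' y + (- m)%:~R.
have wI : lo N y < w < hi N y.
  have /andP[yl yh] := lo_lt_hi actN nfix_y.
  rewrite /w mulrNz ltrBrDr ltrBlDr -E1 -E2 !circle_map_lt// yl yh//.
have := slope_pos actN slope_tau a0 wI.
rewrite -(circle_map_lt cHn) (normalizes_iter _ norm_h) /w circle_map_addz//.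
rewrite iterH'K circle_map_addz// ltrD2r => /ltW.
by rewrite -{1}(N0 y) => /tle; rewrite (slope0 slope_tau).
Qed.

(** The determinant f k of the forms [tau] and [tau \o h ^+ k] satisfies the
linear recurrence of the powers of [h], so that it grows unless f 1 = 0; but it
vanishes for some k > 0. *)
Lemma slope_eigenvector : tau e1 * tau (h *m e2) - tau e2 * tau (h *m e1) = 0.
Proof.
have [n [m [n0 E1 E2]]] := hyperbolic_recurrent.
pose f k := tau e1 * tau (h ^+ k *m e2) - tau e2 * tau (h ^+ k *m e1).
have fn : f n = 0.
  apply: half_planes_parallel => i j.
  have coords (M : 'M[int]_2) : tau (M *m e1) * i%:~R + tau (M *m e2) * j%:~R =
      tau (M *m (e1 *~ i + e2 *~ j)).
    have [tD _ _] := slope_tau.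
    by rewrite mulmxDr tD !mulmxMz !(slope_mulrz _ _ slope_tau) !mulrzr.
  rewrite coords -[e1 in X in X -> _]mul1mx -[e2 in X in X -> _]mul1mx coords mul1mx.
  exact: recurrent_slope_pos E1 E2 _.
have frec k : f k.+2 = t%:~R * f k.+1 - f k.
  by rewrite /f !(slope_recurrence norm_h tr_h _ slope_tau); ring.
have f0 : f 0%N = 0 by rewrite /f expr0 !mul1mx mulrC subrr.
apply/eqP/negPn/negP => f1; have {}f1 : f 1%N != 0 by rewrite /f expr1.
have grow k : 2 * `|f k| <= `|f k.+1|.
  apply: (recurrence_growth hyp_t frec).
  by rewrite f0 normr0 mulr0.
have fpos k : 0 < `|f k.+1|.
  elim: k => [|k IH]; first by rewrite normr_gt0.
  by have := grow k.+1; lra.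
by have := fpos n.-1; rewrite prednK// fn normr0 ltxx.
Qed.

End Eigenvector.

(** The left-hand side of the conclusion is the resultant of the two forms. *)
Lemma binary_forms_resultant (F : fieldType) (al b c be q r u v : F) :
  (u = 0 -> v = 0 -> False) -> b * u ^+ 2 - al * u * v - c * v ^+ 2 = 0 ->
  q * u ^+ 2 - be * u * v - r * v ^+ 2 = 0 ->
  (b * r - c * q) ^+ 2 + (al * q - b * be) * (c * be - r * al) = 0.
Proof.
move=> uv E1 E2.
case: (eqVneq u 0) => [u0|u0].
  have v0 : v != 0 by apply/eqP => /(uv u0).
  have sq0 x : x * v ^+ 2 = 0 -> x = 0.
    by move=> /eqP; rewrite mulf_eq0 expf_eq0 (negPf v0) orbF => /eqP.
  have -> : c = 0.
    by apply: sq0; rewrite -[RHS]oppr0 -E1 u0; ring.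
  have -> : r = 0.
    by apply: sq0; rewrite -[RHS]oppr0 -E2 u0; ring.
  by ring.
have u20 : u ^+ 2 != 0 by rewrite expf_neq0.
case: (eqVneq v 0) => [v0|v0].
  have sq0 x : x * u ^+ 2 = 0 -> x = 0.
    by move=> /eqP; rewrite mulf_eq0 (negPf u20) orbF => /eqP.
  have -> : b = 0 by apply: sq0; rewrite -E1 v0; ring.
  have -> : q = 0 by apply: sq0; rewrite -E2 v0; ring.
  by ring.
apply: (mulfI (mulf_neq0 u20 (expf_neq0 2 v0))); rewrite mulr0.
have R1 : v * ((b * r - c * q) * v - (al * q - b * be) * u) = 0.
  transitivity (b * (q * u ^+ 2 - be * u * v - r * v ^+ 2) * (- 1) +
    q * (b * u ^+ 2 - al * u * v - c * v ^+ 2)); first by ring.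
  by rewrite E1 E2; ring.
have R2 : u * ((b * r - c * q) * u + (c * be - r * al) * v) = 0.
  transitivity (r * (b * u ^+ 2 - al * u * v - c * v ^+ 2) -
    c * (q * u ^+ 2 - be * u * v - r * v ^+ 2)); first by ring.
  by rewrite E1 E2; ring.
move: (al * q - b * be) (b * r - c * q) (c * be - r * al) R1 R2 => f e g R1 R2.
have {}R1 : e * v = f * u.
  by apply/eqP; rewrite -subr_eq0; move/eqP: R1; rewrite mulf_eq0 (negPf v0).
have {}R2 : e * u = - (g * v).
  by apply/eqP; rewrite -subr_eq0 opprK; move/eqP: R2; rewrite mulf_eq0 (negPf u0).
have -> : u ^+ 2 * v ^+ 2 * (e ^+ 2 + f * g) =
    u * v * ((e * v) * (e * u) + (f * u) * (g * v)) by ring.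
by rewrite R1 R2; ring.
Qed.

(** In the coordinates of [tau], being an eigenvector of a matrix is a
quadratic equation, whose coefficients are those of the matrix. *)
Lemma common_eigenvector_cross (R : realType) (N : 'cV[int]_2 -> R -> R) y tau
    (X Y : SL2Z) : slope N y tau ->
  (forall Z, Z = X \/ Z = Y ->
    tau (delta_mx 0 0) * tau (val Z *m delta_mx 1 0) -
    tau (delta_mx 1 0) * tau (val Z *m delta_mx 0 0) = 0) ->
  SL2Z_cross X Y = 0.
Proof.
move=> st eig; have [tD [c c1] _] := st.
set u := tau (delta_mx 0 0) in eig; set v := tau (delta_mx 1 0) in eig.
have coords a : tau a = u * (a 0 0)%:~R + v * (a 1 0)%:~R.
  by have := slope_coords st 1%:M a; rewrite !mul1mx.
have uv : u = 0 -> v = 0 -> False.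
  by move=> u0 v0; move: c1; rewrite coords u0 v0 !mul0r addr0 => /eqP; rewrite eq_sym oner_eq0.
have colE (Z : SL2Z) (j : 'I_2) : tau (val Z *m delta_mx j 0) =
    u * (val Z 0 j)%:~R + v * (val Z 1 j)%:~R.
  by rewrite -colE coords !mxE.
have EX := eig X (or_introl erefl); have EY := eig Y (or_intror erefl).
rewrite !colE in EX EY; apply/eqP; rewrite -(intr_eq0 R); apply/eqP.
rewrite /SL2Z_cross /cross_form /cross1 /cross2 /cross3.
rewrite intrD rmorphXn /= !(intrM, intrB).
apply: (binary_forms_resultant uv); [rewrite -[RHS]EX | rewrite -[RHS]EY]; ring.
Qed.

(** * The embedding *)

Section Embedding.
Variables (R : realType) (G : groupClosed SL2Z).
Variable phi : {multiplicative semidirect G -> diff1p R}.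
Hypothesis phi_inj : injective phi.

Let plane (a : 'cV[int]_2) : semidirect G := (1%g, a).
Let linear (g : subgroup_type G) : semidirect G := (g, 0).

Let phiM p q : phi (p * q)%g = diff1p_comp (phi p) (phi q).
Proof. exact: gmulfM. Qed.

Let plane_mul a b : (plane a * plane b)%g = plane (a + b).
Proof. by rewrite /plane -[LHS]/(_, _) /= mulg1 mul1mx. Qed.

Let linear_plane g a :
  (linear g * plane a)%g = (plane (val (val g) *m a) * linear g)%g.
Proof.
rewrite /plane /linear -[LHS]/(_, _) -[RHS]/(_, _) /=.
by rewrite mulg1 mul1g mulmx0 add0r addr0.
Qed.

Let phi_plane0 : phi (plane 0) = diff1p_one R :> diff1p R.
Proof.
have E : phi (plane 0) = (phi (plane 0) * phi (plane 0))%g.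
  by rewrite -[RHS]gmulfM plane_mul addr0.
by apply: (mulgI (phi (plane 0))); rewrite -E; exact/esym/mulg1.
Qed.

Let phi_planeD a b : diff1p_fun (phi (plane (a + b))) =
  phi (plane a) \o phi (plane b).
Proof. by rewrite -plane_mul phiM. Qed.

Let phi_linear g a : phi (linear g) \o phi (plane a) =
  phi (plane (val (val g) *m a)) \o phi (linear g).
Proof.
have := phiM (linear g) (plane a); rewrite linear_plane phiM => /(congr1 (@diff1p_fun R)).
exact: esym.
Qed.

Variable X : subgroup_type G.
Hypothesis hypX : hyperbolic (val X).
Let k := \det (val (val X) - 1%:M).

Let k_neq0 : k != 0.
Proof.
have := hypX; rewrite /hyperbolic /k det_mx2 /mxtrace sum_ord2 !mxE /=.
have := SL2Z_det (val X); rewrite /= !subr0.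
move: (sval (sval X) 0 0) (sval (sval X) 0 1) (sval (sval X) 1 0)
  (sval (sval X) 1 1) => a b c d D t3; apply/eqP => k0.
have E : a + d = 2 by lia.
by rewrite E in t3.
Qed.

(** By the adjugate formula k a = X b - b for some b, so that k a acts by the
commutator of X and b. *)
Let lift_with_fixed_point a :
  exists F, lifts F (phi (plane (k *: a))) /\ exists x, F x = x.
Proof.
pose b := \adj (val (val X) - 1%:M) *m a.
have Xb : val (val X) *m b = k *: a + b.
  have : (val (val X) - 1%:M) *m b = k *: a.
    by rewrite mulmxA mul_mx_adj mul_scalar_mx.
  by rewrite mulmxBl mul1mx => <-; rewrite subrK.
have [U liftU] := ex_lift (phi (linear X)).
have [V liftV] := ex_lift (phi (plane b)).
have [W liftW] := ex_lift (phi (plane (k *: a))).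
have UV := lifts_comp liftU liftV.
have WVU := lifts_comp liftW (lifts_comp liftV liftU).
have E : phi (linear X) \o phi (plane b) =
    phi (plane (k *: a)) \o (phi (plane b) \o phi (linear X)).
  by rewrite phi_linear Xb phi_planeD.
rewrite E in UV; have [m Em] := lifts_unique WVU UV.
have liftW' := lifts_addz m liftW.
exists (fun x => W x + m%:~R); split=> //.
apply: (commutator_fixed_point liftU.1 liftV.1 liftW'.1); first exact: Em.
by apply: (lifts_commute liftW' liftV); rewrite -!phi_planeD addrC.
Qed.

(** Choosing for each element of k Z^2 its lift with a fixed point gives an
action on the line: two such lifts have a common fixed point, so that their
product has one too. *)
Lemma embedding_plane_action : exists N, plane_action N /\
  forall a, lifts (N a) (phi (plane (k *: a))).
Proof.
have [N NP] := choice lift_with_fixed_point; exists N.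
have lN a := (NP a).1; have fN a := (NP a).2.
have cN a := (lN a).1; split=> //.
have comm a b x : N a (N b x) = N b (N a x).
  by apply: (lifts_commute (lN a) (lN b)); rewrite -!phi_planeD addrC.
have common a b : exists x, N a x = x /\ N b x = x.
  have [Fa [lFa FaK FaK']] := lifts_inv (lN a).
  have [Fb [lFb FbK FbK']] := lifts_inv (lN b).
  exact: (common_fixed_point (cN a) lFa.1 (cN b) lFb.1 FaK FaK' FbK FbK' (comm a b)).
have N0 x : N 0 x = x.
  have l0 : lifts (@id R) (phi (plane (k *: 0))).
    by rewrite scaler0 phi_plane0; split; [exact: circle_map_id|].
  by rewrite (lifts_fixed_unique (lN 0) l0 (fN 0)); last by exists 0.
have ND a b x : N (a + b) x = N a (N b x).
  have lab := lifts_comp (lN a) (lN b).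
  rewrite -phi_planeD -scalerDr in lab.
  have [z [za zb]] := common a b.
  rewrite (lifts_fixed_unique (lN (a + b)) lab (fN (a + b)))//.
  by exists z; rewrite /= zb za.
split=> //.
have [p [p1 p2]] := common (delta_mx 0 0) (delta_mx 1 0).
by exists p => a; exact: fixed_by_generators.
Qed.

Variable N : 'cV[int]_2 -> R -> R.
Hypothesis actN : plane_action N.
Hypothesis lN : forall a, lifts (N a) (phi (plane (k *: a))).

Lemma embedding_normalizes (Z : subgroup_type G) : exists H H',
  normalizes N (val (val Z)) (val (val Z)^-1%g) H H'.
Proof.
have [cN N0 ND [p Np]] := actN.
have [H lH] := ex_lift (phi (linear Z)).
have [H' [lH' HK H'K]] := lifts_inv lH.
exists H, H'; split=> //.
- by split; [exact: lH.1 | exact: lH'.1].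
- split; first by rewrite -[LHS]/(val (val Z * (val Z)^-1)%g) mulgV.
  by rewrite -[LHS]/(val ((val Z)^-1 * val Z)%g) mulVg.
move=> a y.
have lconj := lifts_comp (lifts_comp lH (lN a)) lH'.
rewrite phi_linear -scalemxAr in lconj.
have E : (phi (plane (k *: (val (val Z) *m a))) \o phi (linear Z)) \o
    diff1p_inv (phi (linear Z)) = phi (plane (k *: (val (val Z) *m a))).
  by apply/funext => z; rewrite /= diff1p_invK.
rewrite E in lconj.
have <- : (H \o N a) \o H' = N (val (val Z) *m a).
  apply: (lifts_fixed_unique lconj (lN _)); last by exists p.
  by exists (H p); rewrite /= HK Np.
by rewrite /= HK.
Qed.

Lemma embedding_moves : exists y, ~ global_fixed N y.
Proof.
apply: contrapT => nomove.
have fixed y : global_fixed N y.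
  by apply: contrapT => ny; apply: nomove; exists y.
have [_ lE] := lN (delta_mx 0 0).
have : plane (k *: delta_mx 0 0) = plane 0.
  apply: phi_inj; rewrite phi_plane0; apply: diff1p_ext; apply/funext => z.
  by move: z; apply: circle_projW => y; rewrite lE fixed.
move=> /(congr1 snd)/matrixP/(_ 0 0); rewrite !mxE /= mulr1 => /eqP.
by rewrite (negPf k_neq0).
Qed.

Lemma embedding_cross_eq0 (Y : subgroup_type G) : hyperbolic (val Y) ->
  SL2Z_cross (val X) (val Y) = 0.
Proof.
move=> hypY; have [y ny] := embedding_moves.
have [tau st] := slope_exists actN ny.
apply: (common_eigenvector_cross st) => Z0 Z0XY.
have [Z [-> hypZ]] : exists Z : subgroup_type G, Z0 = val Z /\ hyperbolic (val Z).
  by case: Z0XY => ->; [exists X | exists Y].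
have [H [H' nH]] := embedding_normalizes Z.
apply: (slope_eigenvector actN ny st nH _ hypZ).
have [i00 i01 i10 i11] := SL2Z_invE (val Z).
apply: eq_mx2; rewrite !mxE /mxtrace ?sum_ord2 ?i00 ?i01 ?i10 ?i11 /= ?subrr//.
by rewrite mulr1n addrC.
Qed.

End Embedding.

Theorem theoremB (R : realType) (G : groupClosed SL2Z)
    (nsolG : ~ solvable_group (subgroup_type G)) :
  ~ exists phi : {multiplicative semidirect G -> diff1p R}, injective phi.
Proof.
move=> [phi phi_inj].
have [X [Y [hypX hypY /eqP cr]]] := nonsolvable_hyperbolic_pair nsolG.
have [N [actN lN]] := embedding_plane_action phi X.
exact: cr (embedding_cross_eq0 phi_inj hypX actN lN hypY).
Qed.
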